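(* Suppose $x_0,y_0\in \mathbb{R}^n$ are distinct and $u\in \mathcal{D}^{1,p}(\mathbb{R}^n)$. Then the following are equivalent. (i) $u$ is an extremal with $$[u]_{C^{1-n/p}(\mathbb{R}^n)}=\frac{|u(x_0)-u(y_0)|}{|x_0-y_0|^{1-n/p}}.$$ (ii) There is a $c\in \mathbb{R}$ for which $u$ satisfies $-\Delta_pu=c(\delta_{x_0}-\delta_{y_0})$ in $\mathbb{R}^n$, meaning that $$\int_{\mathbb{R}^n}|Du|^{p-2}Du\cdot D\phi\, dx=c(\phi(x_0)-\phi(y_0))\quad\text{for each }\phi\in \mathcal{D}^{1,p}(\mathbb{R}^n).$$ (iii) For each $v\in \mathcal{D}^{1,p}(\mathbb{R}^n)$ with $v(x_0)=u(x_0)$ and $v(y_0)=u(y_0)$, $$\int_{\mathbb{R}^n}|Du|^pdx\le \int_{\mathbb{R}^n}|Dv|^pdx.$$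
   Context: Throughout, $n\ge 1$ is an integer and $n<p<\infty$. $\mathcal{D}^{1,p}(\mathbb{R}^n)$ is the space of $u\in L^1_{\mathrm{loc}}(\mathbb{R}^n)$ whose weak first-order partial derivatives all belong to $L^p(\mathbb{R}^n)$. Every such $u$ has a Hölder continuous representative and is always identified with it. Put $[u]_{C^{1-n/p}(\mathbb{R}^n)}:=\sup_{x\ne y}\frac{|u(x)-u(y)|}{|x-y|^{1-n/p}}$ and $\|Du\|_{L^p(\mathbb{R}^n)}:=\left(\int_{\mathbb{R}^n}|Du|^p\,dx\right)^{1/p}$. Morrey's inequality says there is a finite constant $C$ with $[u]_{C^{1-n/p}(\mathbb{R}^n)}\le C\|Du\|_{L^p(\mathbb{R}^n)}$ for all $u\in\mathcal{D}^{1,p}(\mathbb{R}^n)$; $C_*$ denotes the sharp (smallest) such constant. An extremal is a function $u\in\mathcal{D}^{1,p}(\mathbb{R}^n)$ with $[u]_{C^{1-n/p}(\mathbb{R}^n)}=C_*\|Du\|_{L^p(\mathbb{R}^n)}$ (constants are allowed). $\Delta_pu=\operatorname{div}(|Du|^{p-2}Du)$ is the $p$-Laplace operator, $\delta_a$ is the Dirac mass at $a$, and $|z|^{p-2}z$ is understood to be $0$ when $z=0$. *)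

(* Defs.v *)
From HB Require Import structures.
From mathcomp Require Import all_boot all_order all_algebra.
From mathcomp Require Import all_classical all_reals all_analysis.
Import Order.TTheory GRing.Theory Num.Theory.
Import numFieldNormedType.Exports.

Set Implicit Arguments.
Unset Strict Implicit.
Unset Printing Implicit Defensive.

Local Open Scope classical_set_scope.
Local Open Scope ring_scope.

Definition measure_rV_display : measure_display -> measure_display.
Proof. exact. Qed.

(* As for [n.-tuple T], the sigma-algebra is generated by the coordinates; over a [realType] it is the Borel sigma-algebra. *)
Section measurable_rV.
Context {d : measure_display} {T : measurableType d} (n : nat).

Let coord : 'I_n -> 'rV[T]_n -> T := fun i x => x ord0 i.

Let rV_set0 : g_sigma_preimage coord set0.
Proof. exact: sigma_algebra0. Qed.

Let rV_setC A : g_sigma_preimage coord A -> g_sigma_preimage coord (~` A).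
Proof. exact: sigma_algebraC. Qed.

Let rV_bigcup (F : (set 'rV[T]_n)^nat) :
  (forall i, g_sigma_preimage coord (F i)) ->
  g_sigma_preimage coord (\bigcup_i (F i)).
Proof. exact: sigma_algebra_bigcup. Qed.

HB.instance Definition _ := @isMeasurable.Build (measure_rV_display d)
  'rV[T]_n (g_sigma_preimage coord) rV_set0 rV_setC rV_bigcup.

Lemma measurable_coord_rV (i : 'I_n) :
  measurable_fun [set: 'rV[T]_n] (fun x : 'rV[T]_n => x ord0 i).
Proof.
move=> _ Y mY; rewrite setTI; apply: sub_sigma_algebra => /=.
rewrite -bigcup_seq/=; exists i => /=; first by rewrite mem_index_enum.
by exists Y => //; rewrite setTI.
Qed.

Lemma measurable_fun_rVP d' (T' : measurableType d') (f : T' -> 'rV[T]_n) :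
  measurable_fun [set: T'] f <->
  forall i, measurable_fun [set: T'] (fun x => f x ord0 i).
Proof.
split=> [mf i|mf].
  exact: (measurableT_comp (measurable_coord_rV i) mf).
move=> _ A mA; rewrite setTI.
apply: (@smallest_sub _ (sigma_algebra setT)
  (\big[setU/set0]_(i < n) preimage_set_system setT (coord i) measurable)
  [set B | measurable (f @^-1` B)]) mA.
  split=> [|B mB|F mF] /=.
  - by rewrite preimage_set0; exact: measurable0.
  - by rewrite setTD preimage_setC; exact: measurableC.
  - by rewrite preimage_bigcup; exact: bigcupT_measurable.
move=> B; rewrite -bigcup_seq => -[i _] [Y mY <-] /=.
by rewrite setTI; have := mf i measurableT Y mY; rewrite setTI.
Qed.

End measurable_rV.

Section lebesgue_rV.
Context {R : realType}.
Local Open Scope ereal_scope.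

Definition cons_rV n (z : R * 'rV[R]_n) : 'rV[R]_n.+1 :=
  row_mx (const_mx z.1 : 'rV_1) z.2.

Definition uncons_rV n (x : 'rV[R]_n.+1) : R * 'rV[R]_n :=
  (x ord0 ord0, @rsubmx _ _ 1 n x).

Lemma cons_rV0 n (z : R * 'rV[R]_n) : cons_rV z ord0 ord0 = z.1.
Proof.
have -> : (ord0 : 'I_n.+1) = lshift n (ord0 : 'I_1) by exact: val_inj.
by apply: etrans (row_mxEl (const_mx z.1) z.2 ord0 ord0) _; rewrite mxE.
Qed.

Lemma cons_rVS n (z : R * 'rV[R]_n) i :
  cons_rV z ord0 (lift ord0 i) = z.2 ord0 i.
Proof.
have -> : lift ord0 i = rshift 1 i by exact: val_inj.
exact: (row_mxEr (const_mx z.1) z.2 ord0 i).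
Qed.

Lemma cons_rVK n : cancel (@cons_rV n) (@uncons_rV n).
Proof.
by move=> [a v]; rewrite /uncons_rV cons_rV0 /cons_rV row_mxKr.
Qed.

Lemma measurable_cons_rV n : measurable_fun setT (@cons_rV n).
Proof.
apply/measurable_fun_rVP => i; case: (unliftP ord0 i) => [j|] ->.
  under eq_fun do rewrite cons_rVS.
  exact: (measurableT_comp (measurable_coord_rV j) measurable_snd).
under eq_fun do rewrite cons_rV0.
exact: measurable_fst.
Qed.

Lemma measurable_uncons_rV n : measurable_fun setT (@uncons_rV n).
Proof.
apply/measurable_fun_pairP; split => /=; first exact: measurable_coord_rV.
apply/measurable_fun_rVP => i.
rewrite (_ : (fun x => _) = fun x : 'rV_n.+1 => x ord0 (rshift 1 i)).
  exact: measurable_coord_rV.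
by apply/funext => x; rewrite mxE.
Qed.

Section step.
Variables (n : nat) (mu : {sigma_finite_measure set 'rV[R]_n -> \bar R}).

Definition lebesgue_rV_step : set 'rV[R]_n.+1 -> \bar R :=
  pushforward (lebesgue_measure \x mu) (@cons_rV n).

HB.instance Definition _ := Measure.copy lebesgue_rV_step
  (measure_function_pushforward__canonical__measure_function_Measure
    (lebesgue_measure \x mu : {measure set _ -> \bar R}) (@measurable_cons_rV n)).

Let lebesgue_rV_step_sigma_finite : sigma_finite setT lebesgue_rV_step.
Proof.
have /sigma_finiteP[F [TF ndF Foo]] := sigma_finiteT (@lebesgue_measure R).
have /sigma_finiteP[G [TG ndG Goo]] := sigma_finiteT mu.
exists (fun k => @uncons_rV n @^-1` (F k `*` G k)).
  rewrite -preimage_bigcup -[LHS](preimage_setT (@uncons_rV n)).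
  congr (_ @^-1` _); apply/esym; rewrite -subTset => -[x y] _.
  have [i _ Fx] : (\bigcup_i F i) x by rewrite -TF.
  have [j _ Gy] : (\bigcup_i G i) y by rewrite -TG.
  exists (maxn i j) => //; split => /=.
  - by move: x Fx; exact/subsetPset/ndF/leq_maxl.
  - by move: y Gy; exact/subsetPset/ndG/leq_maxr.
move=> k; have [mFk Fk_fin] := Foo k; have [mGk Gk_fin] := Goo k; split.
  rewrite -[X in measurable X]setTI; apply: measurable_uncons_rV => //.
  exact: measurableX.
rewrite /lebesgue_rV_step /pushforward -comp_preimage.
rewrite (_ : _ \o _ = id); last by apply/funext => z /=; rewrite cons_rVK.
by rewrite preimage_id product_measure1E// lte_mul_pinfty// ge0_fin_numE.
Qed.

HB.instance Definition _ := Measure_isSigmaFinite.Build _ _ _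
  lebesgue_rV_step lebesgue_rV_step_sigma_finite.

End step.

(* The [n]-fold product of Lebesgue measure on [R]; see [lebesgue_rV_box]. *)
Fixpoint lebesgue_rV n : {sigma_finite_measure set 'rV[R]_n -> \bar R} :=
  match n with
  | 0 => \d_(0%R : 'rV[R]_0)
  | n'.+1 => lebesgue_rV_step (lebesgue_rV n')
  end.

Lemma measurable_rV_box n (A : 'I_n -> set R) :
  (forall i, measurable (A i)) ->
  measurable [set x : 'rV[R]_n | forall i, A i (x ord0 i)].
Proof.
move=> mA; rewrite (_ : mkset _ =
    \bigcap_(i in [set: 'I_n]) [set x : 'rV[R]_n | A i (x ord0 i)]).
  apply: fin_bigcap_measurable => // i _.
  by have := @measurable_coord_rV _ R n i measurableT _ (mA i); rewrite setTI.
by apply/seteqP; split => x /= Ax => [i _|i]; exact: Ax.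
Qed.

Lemma lebesgue_rV_box n (A : 'I_n -> set R) : (forall i, measurable (A i)) ->
  lebesgue_rV n [set x | forall i, A i (x ord0 i)] =
  \prod_(i < n) lebesgue_measure (A i).
Proof.
elim: n A => [|n ih] A mA.
  by rewrite big_ord0 /= diracE mem_set// => -[].
rewrite big_ord_recl -ih//= /lebesgue_rV_step /pushforward.
have mB := @measurable_rV_box n (fun i => A (lift ord0 i)) (fun i => mA _).
rewrite -(product_measure1E _ (lebesgue_rV n))//; last exact: (mA ord0).
congr (product_measure1 _ _ _); apply/seteqP; split => z /= => [Az|[A0 AS] i].
  by split => [|i]; [rewrite -(cons_rV0 z)|rewrite -cons_rVS].
by case: (unliftP ord0 i) => [j|] ->; rewrite ?cons_rVS ?cons_rV0.
Qed.

End lebesgue_rV.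
Arguments lebesgue_rV {R n}.

Section homogeneous_sobolev.
Context {R : realType} {n : nat}.
Implicit Types (u phi g : 'rV[R]_n -> R) (p : R) (i : 'I_n) (x y z : 'rV[R]_n).

Local Notation mu := (@lebesgue_rV R n).

(* The library norm [`|x|] on row vectors is the sup norm. *)
Definition enorm x : R := Num.sqrt (\sum_i x ord0 i ^+ 2).

Definition edot x y : R := \sum_i x ord0 i * y ord0 i.

Definition partial i phi : 'rV[R]_n -> R :=
  fun x => 'D_(delta_mx ord0 i) phi x.

Definition smooth phi := forall s : seq 'I_n,
  continuous (foldr partial phi s) /\
  forall i x, derivable (foldr partial phi s) x (delta_mx ord0 i).

Definition test_function phi :=
  smooth phi /\ compact (closure [set x | phi x != 0]).

Definition L1loc u :=
  measurable_fun setT u /\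
  forall K : set 'rV[R]_n, compact K ->
    (\int[mu]_(x in K) `|(u x)%:E| < +oo)%E.

Definition weak_partial u i g :=
  L1loc g /\
  forall phi, test_function phi ->
    (\int[mu]_x (u x * partial i phi x)%:E = - \int[mu]_x (g x * phi x)%:E)%E.

(* Elements of [D^{1,p}(R^n)] are identified with their continuous
   representatives, whence the continuity requirement. *)
Definition D1p p u :=
  [/\ continuous u, L1loc u &
      forall i, exists2 g, weak_partial u i g & g \in Lfun mu p%:E].

(* Weak partial derivatives are unique up to a null set; [wgrad] picks one
   representative of each. *)
Definition wgrad u x : 'rV[R]_n :=
  \row_i xget (cst 0) [set g | weak_partial u i g] x.

Definition grad_Lnorm p u : \bar R :=
  Lnorm mu p%:E (fun x => (enorm (wgrad u x))%:E).

(* [|z|^(p-2) z]; it vanishes at [z = 0], also when [p < 2]. *)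
Definition p_flux p z : 'rV[R]_n := enorm z `^ (p - 2) *: z.

Definition holder_quotient p u x y : R :=
  `|u x - u y| / enorm (x - y) `^ (1 - n%:R / p).

Definition holder_seminorm p u : \bar R :=
  ereal_sup [set (holder_quotient p u z.1 z.2)%:E
            | z in [set z : 'rV[R]_n * 'rV[R]_n | z.1 != z.2]].

Definition morrey_bound p (C : R) :=
  forall v, D1p p v -> (holder_seminorm p v <= C%:E * grad_Lnorm p v)%E.

(* The smallest constant in Morrey's inequality; an infimum of finite
   constants, taken in [\bar R] so that no finiteness is presupposed. *)
Definition morrey_constant p : \bar R :=
  ereal_inf [set C%:E | C in morrey_bound p].

Definition extremal p u :=
  D1p p u /\ (holder_seminorm p u = morrey_constant p * grad_Lnorm p u)%E.

End homogeneous_sobolev.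

(* Main.v *)
(* Let E u be the integral of |Du|^p.  Neither Morrey's inequality nor the
   existence of a nonconstant extremal is needed.
   (i) => (ii): put K = [u] / ||Du||.  Since C_* = K, for every phi the quantity
   |u(x0) - u(y0) + t (phi(x0) - phi(y0))|^p is at most a constant times
   E (u + t phi), with equality at t = 0; convexity of both sides turns this
   into an identity between the first variations.
   (ii) => (iii): integrate |z|^p >= |w|^p + p |w|^(p-2) w . (z - w) with w = Du
   and z = Dv, and test (ii) with v - u.
   (iii) => (i): the ratio of a Hoelder quotient of v at (x, y) to ||Dv|| is
   invariant under similarities.  Carrying (x0, y0) to (x, y) by a similarity
   and normalizing v affinely gives a competitor for u, so that no ratio exceeds
   the one of u at (x0, y0), which is therefore C_*.
   The degenerate case ||Du|| = 0 uses that a continuous function with zero weak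
   gradient is constant. *)
From HB Require Import structures.
Require Import Defs.
From mathcomp Require Import all_boot all_order all_algebra.
From mathcomp Require Import all_classical all_reals all_analysis
    measurable_realfun.
From mathcomp Require Import ring lra.
Import Order.TTheory GRing.Theory Num.Theory.
Import numFieldNormedType.Exports.
Set Implicit Arguments.
Unset Strict Implicit.
Unset Printing Implicit Defensive.
Local Open Scope classical_set_scope.
Local Open Scope ring_scope.

(** * Smooth bumps on the line *)

Section smooth1.
Context {R : realType}.
Implicit Types (f g : R -> R) (a b c x : R).

(** The invariance under similarities rests on one exponent: a similarity of ratio [s] multiplies
    the energy by [s] to the power [p - n], and the [p]-th root of this factor, [s] to the power
    [1 - n / p], is exactly what the Hoelder denominator picks up. The main obstacle is that [wgrad]
    is an arbitrary choice of representatives, so no formula for the gradient of a sum or of a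
    composition holds pointwise. Gradients are computed for convenient fields [G] with
    [is_wgrad p u G], and integrals are transferred to [wgrad] by uniqueness almost everywhere. This
    uniqueness is the fundamental lemma of the calculus of variations, obtained by testing against
    explicit bumps that tend to indicators of boxes. Lebesgue measure is an iterated product here,
    so its invariance under orthogonal maps is not visible from the definition. It comes from the
    Fubini argument behind the uniqueness of Haar measure, normalized on the unit ball. The Morrey
    constant lives in [\bar R]. For positive energy it is finite in (i) because its product with
    [||Du||] is an attained quotient, and in the step from (iii) because the ratio of the minimizer
    is itself a bound. *)

Fixpoint nderivable (n : nat) f : Prop :=
  if n is n'.+1 then (forall x, derivable f x 1) /\ nderivable n' (derive1 f)
  else True.

Definition smooth1 f := forall n, nderivable n f.

Lemma smooth1_derivable f x : smooth1 f -> derivable f x 1.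
Proof. by move=> /(_ 1%N)[]. Qed.

Lemma smooth1_derive f : smooth1 f -> smooth1 (derive1 f).
Proof. by move=> sf n; have [] := sf n.+1. Qed.

Lemma smooth1_continuous f : smooth1 f -> continuous f.
Proof.
move=> sf x; apply/differentiable_continuous/derivable1_diffP.
exact: smooth1_derivable.
Qed.

Lemma nderivableS n f : nderivable n.+1 f -> nderivable n f.
Proof. by elim: n f => //= n ih f [df [ddf nf]]; split=> //; exact: ih. Qed.

Lemma nderivableD n f g : nderivable n f -> nderivable n g ->
  nderivable n (f \+ g).
Proof.
elim: n f g => //= n ih f g [df nf] [dg ng]; split.
  by move=> x; exact: derivableD.
rewrite (_ : derive1 (f \+ g) = (derive1 f) \+ (derive1 g)); first exact: ih.
by apply/funext => x; rewrite [LHS]derive1E [RHS]/= !derive1E; exact: deriveD.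
Qed.

Lemma nderivableZ n f c : nderivable n f -> nderivable n (fun x => c * f x).
Proof.
elim: n f => //= n ih f [df nf]; split.
  by move=> x; exact: (@derivableZ _ R R f c x 1 (df x)).
rewrite (_ : derive1 (fun x => c * f x) = fun x => c * (derive1 f) x); first
    exact: ih.
by apply/funext => x; rewrite !derive1E; exact: (@deriveZ _ R R f c x 1 (df x)).
Qed.

Lemma nderivableM n f g : nderivable n f -> nderivable n g ->
  nderivable n (f \* g).
Proof.
elim: n f g => //= n ih f g [df nf] [dg ng]; split.
  by move=> x; exact: derivableM.
rewrite (_ : derive1 (f \* g) = (f \* (derive1 g)) \+ ((derive1 f) \* g)).
  by apply: nderivableD; apply: ih => //; apply: nderivableS; split.
apply/funext => x; rewrite [LHS]derive1E [RHS]/= !derive1E mulrC.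
by rewrite [X in _ + X]mulrC [X in X + _]mulrC; exact: deriveM.
Qed.

Lemma is_deriveZl f c x d : is_derive x 1 f d ->
  is_derive x 1 (fun y => c * f y) (c * d).
Proof. by move=> H; exact: (is_deriveZ c H). Qed.

Lemma is_derive_mul f g x df dg : is_derive x 1 f df -> is_derive x 1 g dg ->
  is_derive x 1 (fun y => f y * g y) (f x * dg + g x * df).
Proof. by move=> H1 H2; exact: (is_deriveM H1 H2). Qed.

Lemma nderivable_affine n f c a : nderivable n f ->
  nderivable n (fun x => f (c * x + a)).
Proof.
elim: n f => //= n ih f [df nf].
have dl x : is_derive x (1 : R) (fun x => c * x + a) c.
  have H1 := is_deriveZl c (is_derive_id x 1).
  have H2 := @is_derive_cst R R R a x 1.
  by apply: is_derive_eq (is_deriveD H1 H2) _; rewrite addr0 mulr1.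
have H x : is_derive x (1 : R) (fun x => f (c * x + a)) (c * (derive1 f) (c *
    x + a)).
  rewrite mulrC; apply: (@is_derive1_comp _ f (fun x => c * x + a) x) => //.
  by rewrite derive1E; apply: derivableP.
split; first by move=> x; exact: ex_derive.
rewrite (_ : derive1 _ = fun x => c * (derive1 f) (c * x + a)).
  exact/nderivableZ/ih.
by apply/funext => x; rewrite derive1E; apply: derive_val.
Qed.

Lemma smooth1M f g : smooth1 f -> smooth1 g -> smooth1 (f \* g).
Proof. by move=> sf sg n; exact: nderivableM. Qed.

Lemma smooth1_affine f c a : smooth1 f -> smooth1 (fun x => f (c * x + a)).
Proof. by move=> sf n; exact: nderivable_affine. Qed.

(* For [k = 0] this is the classical smooth function with all derivatives zero
   at the origin; the weights [x ^- k] make the family stable under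
   derivation. *)
Definition expV (c : R) (k : nat) (x : R) : R :=
  if 0 < x then x ^- k * expR (- (c / x)) else 0.

(** After a [k]-th root the bound reads [c / k <= x * expR (c / (k * x))], which follows from
    [1 + y <= expR y]; hence the constant [(k / c) ^ k], equal to 1 for [k = 0]. *)
Lemma expV_le (c : R) k : 0 < c -> exists2 M : R, 0 <= M &
  forall x, 0 < x -> x ^- k * expR (- (c / x)) <= M.
Proof.
move=> c0; exists ((k%:R / c) ^+ k).
  by rewrite exprn_ge0// divr_ge0// ltW.
move=> x x0; case: k => [|k].
  by rewrite !expr0 invr1 mul1r -expR0 ler_expR oppr_le0 divr_ge0// ltW.
have k0 : 0 < k.+1%:R :> R by rewrite ltr0n.
have -> : c / x = (c / x / k.+1%:R) *+ k.+1.
  by rewrite -mulr_natr divfK// gt_eqF.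
rewrite expRN -mulr_natr expRM_natr -exprVn -exprVn -exprMn lerXn2r ?nnegrE//.
- by rewrite mulr_ge0// invr_ge0 ?expR_ge0// ltW.
- by rewrite divr_ge0// ltW.
rewrite -invfM invf_ple ?posrE ?mulr_gt0 ?invr_gt0 ?expR_gt0//.
rewrite invfM invrK (le_trans _ (ler_wpM2l (ltW x0) (expR_ge1Dx _)))//.
rewrite mulrDr mulr1 (_ : x * _ = k.+1%:R^-1 * c) ?lerDr ?ltW//.
by field; rewrite !gt_eqF.
Qed.

Lemma expV_is_derive c k x : 0 < c -> is_derive x 1 (expV c k)
   (- k%:R * expV c k.+1 x + c * expV c k.+2 x).
Proof.
move=> c0; have [x0|x0|->] := ltgtP x 0.
- have -> : - k%:R * expV c k.+1 x + c * expV c k.+2 x = 0.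
    by rewrite /expV ltNge (ltW x0)/= !mulr0 addr0.
  apply: (@near_eq_is_derive _ _ _ (cst 0)) => //.
  near=> y; rewrite /expV ifF//; apply/negbTE; rewrite -leNgt ltW//.
  by near: y; exact: lt_nbhsl.
- have xN0 : x != 0 by rewrite gt_eqF.
  have H : is_derive x (1 : R) (fun x => x ^- k * expR (- (c / x)))
     (- k%:R * expV c k.+1 x + c * expV c k.+2 x).
    have H1 : is_derive x (1 : R) (fun x => x^-1) (- x ^- 2).
      by apply: is_derive_eq; first (by apply: is_deriveV); rewrite
          /GRing.scale/= mulr1.
    have H2 : is_derive x (1 : R) (fun x => (x ^-1)^+k) (- k%:R * x ^- k.+1).
      have := @is_deriveX _ _ (fun x => x^-1) k x 1 _ H1.
      move=> H; apply: (@is_derive_eq _ _ _ _ _ _ _ _ (eq_ind _ (fun f =>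
          is_derive x 1 f _) H _ _)).
        by apply/funext => y; rewrite exprfctE.
      case: k {H} => [|k] /=; first by rewrite mul0r scale0r oppr0 mul0r.
      by rewrite /GRing.scale/= -!exprVn !exprS; ring.
    have H3 : is_derive x (1 : R) (fun x => expR (- (c / x))) (expR (- (c /
        x)) * (c / x ^+ 2)).
      have H4 : is_derive x (1 : R) (fun x => (- c) * x^-1) (c / x ^+ 2).
        by apply: is_derive_eq (is_deriveZl (- c) H1) _; rewrite mulrNN.
      have -> : (fun x => expR (- (c / x))) = expR \o (fun x => (- c) * x^-1).
        by apply/funext => y /=; rewrite mulNr.
      rewrite -[X in expR X]mulNr.
      exact: is_derive1_comp.
    have -> : (fun x => x ^- k * expR (- (c / x))) =
        (fun x => (x^-1) ^+ k * expR (- (c / x))).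
      by apply/funext => y /=; rewrite exprVn.
    apply: (is_derive_eq (is_derive_mul H2 H3)).
    rewrite /expV x0 /GRing.scale/= -!exprVn !exprS; field.
    by rewrite ?xN0.
  apply: (@near_eq_is_derive R R R _ _ x 1 _ _ H) => //.
  near=> y; rewrite /expV ifT//.
  by near: y; exact: lt_nbhsr.
- have -> : - k%:R * expV c k.+1 0 + c * expV c k.+2 0 = 0.
    by rewrite /expV ltxx/= !mulr0 addr0.
  have [M M0 HM] := @expV_le c k.+2 c0.
  have H : h^-1 *: (expV c k (h *: (1:R) + 0) - expV c k 0) @[h --> 0^'] -->
      (0:R).
    apply/cvgr0Pnorm_le => e e0; near=> h.
    rewrite /expV ltxx subr0 addr0 /GRing.scale/= mulr1.
    case: ifPn => h0; last by rewrite mulr0 normr0 ltW.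
    rewrite ger0_norm; last by rewrite mulr_ge0 ?invr_ge0 ?ltW// mulr_gt0//
        ?expR_gt0// invr_gt0 exprn_gt0.
    (* The weight is raised to [k.+2], one more than the quotient requires, so that a factor [h] is
       left over: the quotient is at most [h * M] and tends to 0. *)
    rewrite (_ : _ * _ = h * (h ^- k.+2 * expR (- (c / h)))); last first.
      by rewrite -!exprVn !exprS; field; rewrite gt_eqF.
    apply: (le_trans (ler_wpM2l (ltW h0) (HM _ h0))).
    have M1 : 0 < M + 1 by rewrite ltr_wpDl.
    apply: (@le_trans _ _ (h * (M + 1))).
      by rewrite ler_wpM2l ?(ltW h0)// lerDl.
    rewrite -ler_pdivlMr//.
    have := ler_norm h; move/le_trans; apply; near: h.
    by apply: dnbhs0_le; rewrite divr_gt0// ltr_wpDl.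
  apply: DeriveDef; first by apply/cvg_ex; exists 0.
  by apply/cvg_lim.
Unshelve. all: by end_near. Qed.

Lemma smooth1_expV c k : 0 < c -> smooth1 (expV c k).
Proof.
move=> c0 n; elim: n k => //= n ih k; split.
  by move=> x; have [] := @expV_is_derive c k x c0.
rewrite (_ : derive1 _ = (fun x => - k%:R * expV c k.+1 x) \+
    (fun x => c * expV c k.+2 x)).
  by apply: nderivableD; exact/nderivableZ/ih.
apply/funext => x; rewrite derive1E.
by have [_ ->] := @expV_is_derive c k x c0.
Qed.

(** For every [c] the bump vanishes off []a, b[]; as [c] tends to 0 it stays in [[0, 1]] and tends
    pointwise to the indicator of this interval. Letting [c] tend to 0 takes the place of a
    mollification. *)
Definition bump (c a b : R) (x : R) : R := expV c 0 (x - a) * expV c 0 (b - x).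

Lemma smooth1_bump c a b : 0 < c -> smooth1 (bump c a b).
Proof.
move=> c0.
have -> : bump c a b = (fun x => expV c 0 (1 * x + - a)) \*
                       (fun x => expV c 0 (-1 * x + b)).
  by apply/funext => x; rewrite /bump/= mul1r mulN1r [- x + b]addrC.
by apply: smooth1M; apply: smooth1_affine; exact: smooth1_expV.
Qed.

Lemma expV0_ge0_le1 c x : 0 < c -> 0 <= expV c 0 x <= 1.
Proof.
move=> c0; rewrite /expV; case: ifP => x0; last by rewrite lexx ler01.
by rewrite expr0 invr1 mul1r expR_ge0 -expR0 ler_expR oppr_le0 divr_ge0// ltW.
Qed.

Lemma bump_ge0_le1 c a b x : 0 < c -> 0 <= bump c a b x <= 1.
Proof.
move=> c0; have /andP[? ?] := expV0_ge0_le1 (x - a) c0.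
have /andP[? ?] := expV0_ge0_le1 (b - x) c0.
by rewrite /bump mulr_ge0// mulr_ile1.
Qed.

Lemma bump_eq0 c a b x : ~~ (a < x < b) -> bump c a b x = 0.
Proof.
rewrite negb_and /bump /expV !subr_gt0 => /orP[] /negbTE ->.
  by rewrite mul0r.
by rewrite mulr0.
Qed.

Lemma bump_cvg a b x :
  bump k.+1%:R^-1 a b x @[k --> \oo] --> (if a < x < b then 1 else 0 : R).
Proof.
case: ifPn => [/andP[ax xb]|nab]; last first.
  by rewrite (_ : (fun k => _) = cst 0)//; [exact: cvg_cst|apply/funext => k;
      rewrite bump_eq0].
have E (y : R) : 0 < y -> expV k.+1%:R^-1 0 y @[k --> \oo] --> (1 : R).
  move=> y0.
  have -> : (fun k => expV k.+1%:R^-1 0 y) = (fun k => expR (- (k.+1%:R^-1 /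
      y))).
    by apply/funext => k; rewrite /expV y0 expr0 invr1 mul1r.
  have H : k.+1%:R^-1 / y @[k --> \oo] --> (0 : R).
    rewrite -[X in _ --> X](mul0r y^-1); apply: cvgM; last exact: cvg_cst.
    exact: (@cvg_harmonic R).
  rewrite -[X in _ --> X]expR0; apply: continuous_cvg; first exact:
      continuous_expR.
  by rewrite -[X in _ --> X]oppr0; exact: cvgN.
by rewrite -[X in _ --> X]mulr1; apply: cvgM; apply: E; rewrite subr_gt0.
Qed.

End smooth1.

(** * Borel sets and compact sets of row vectors *)

Section topology_rV.
Context {R : realType} {n : nat}.
Implicit Types (x y : 'rV[R]_n) (A K : set 'rV[R]_n).

Lemma nbhs_rVP x A : nbhs x A <->
  exists2 e : R, 0 < e & forall y, (forall i, `|x ord0 i - y ord0 i| < e) -> A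
      y.
Proof.
split=> [/nbhs_ballP[e e0 eA]|[e e0 eA]].
  exists e => // y xy; apply: eA; split => // i j.
  by rewrite ord1; exact: xy.
apply/nbhs_ballP; exists e => // y [_ xy]; apply: eA => i.
exact: xy.
Qed.

(** The sigma-algebra is generated by the coordinates, not by the topology. An open set is therefore
    written as a union over a countable index set of boxes with rational centre and radius
    [1 / (k + 1)], keeping those that it contains. *)
Lemma open_measurable_rV A : open A -> measurable A.
Proof.
move=> oA.
pose box (q : 'rV[rat]_n * nat) := [set y | forall i,
  `]ratr (q.1 ord0 i) - q.2.+1%:R^-1, ratr (q.1 ord0 i) + q.2.+1%:R^-1[%classic
    (y ord0 i)] : set 'rV[R]_n.
have -> : A = \bigcup_q (if `[< box q `<=` A >] then box q else set0).
  apply/seteqP; split => [x Ax|x [q _]]; last by case: ifPn => // /asboolP;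
      exact.
  have [e e0 eA] := (nbhs_rVP x A).1 (open_nbhs_nbhs (conj oA Ax)).
  have e2 : 0 < e / 2 by rewrite divr_gt0.
  (* The centre lies within one radius of [x] and the box reaches one radius further, so twice the
     radius has to stay below [e]. *)
  pose k := Num.trunc (e / 2)^-1.
  have ke : k.+1%:R^-1 < e / 2.
    by rewrite invf_plt ?posrE//; exact: truncnS_gt.
  have k0 : 0 < k.+1%:R^-1 :> R by rewrite invr_gt0.
  have H i : exists q : rat, `|x ord0 i - ratr q| < k.+1%:R^-1.
    have /rat_in_itvoo[q] : x ord0 i - k.+1%:R^-1 < x ord0 i + k.+1%:R^-1.
      by rewrite ltrD2l gtrN.
    by rewrite in_itv/= => qx; exists q; rewrite distrC ltr_distl.
  have [f fP] := choice H.
  exists (\row_i f i, k) => //.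
  have sub : box (\row_i f i, k) `<=` A.
    move=> y /= By; apply: eA => i.
    have := By i; rewrite /= in_itv/= mxE -ltr_distl => yi.
    rewrite -(subrKA (ratr (f i))) (le_lt_trans (ler_normD _ _))//.
    rewrite (splitr e) ltrD// (lt_trans _ ke)//.
    by rewrite distrC.
  case: ifPn => [_|/asboolP//] i /=; rewrite mxE.
  by have := fP i; rewrite ltr_distl in_itv/=.
apply: countable_bigcupT_measurable => // q; case: ifPn => // _.
by apply: (@measurable_rV_box _ _ (fun i => `]ratr (q.1 ord0 i) -
    q.2.+1%:R^-1, ratr (q.1 ord0 i) + q.2.+1%:R^-1[%classic)) => i; exact:
    measurable_itv.
Qed.

Lemma compact_measurable_rV K : compact K -> measurable K.
Proof.
move=> cK; rewrite -(setCK K); apply: measurableC; apply: open_measurable_rV.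
by apply: closed_openC; apply: compact_closed => //; exact: norm_hausdorff.
Qed.

Lemma continuous_measurable_rV (f : 'rV[R]_n -> R) :
  continuous f -> measurable_fun setT f.
Proof.
move=> /continuousP cf; apply: (measurability _ (RGenOpens.measurableE R)).
move=> _ [_ [a [b ->] <-]]; rewrite setTI; apply: open_measurable_rV.
exact/cf/interval_open.
Qed.

Definition cube (M : R) : set 'rV[R]_n := [set x | forall i, `[-M, M]%classic
    (x ord0 i)].

Lemma measurable_cube M : measurable (cube M).
Proof. by apply: (@measurable_rV_box _ _ (fun=> `[-M, M]%classic)) => i;
    exact: measurable_itv. Qed.

Lemma compact_cube M : compact (cube M).
Proof.
by apply: (@rV_compact _ _ (fun=> `[-M, M]%classic)) => i; exact:
    segment_compact.
Qed.

Lemma lebesgue_cube M : (lebesgue_rV (cube M) < +oo)%E.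
Proof.
rewrite /cube (lebesgue_rV_box (A := fun=> `[-M, M]%classic)); last first.
  by move=> i; exact: measurable_itv.
rewrite -ge0_fin_numE; last by apply: prode_ge0.
apply: prode_fin_num => i _; rewrite lebesgue_measure_itv.
by case: ifP.
Qed.

Lemma compact_cubeP K : compact K -> exists M, K `<=` cube M.
Proof.
move=> /compact_bounded[M [_ HM]]; exists (M + 1) => x Kx i.
have := HM (M + 1); rewrite ltrDl => /(_ ltr01 x Kx) xM.
rewrite /= in_itv/= -ler_norml (le_trans _ xM)// /Num.norm/= mx_normrE.
by apply/bigmax_geP; right => /=; exists (ord0, i).
Qed.

Lemma lebesgue_compact K : compact K -> (lebesgue_rV K < +oo)%E.
Proof.
move=> cK; have [M KM] := compact_cubeP cK.
apply: le_lt_trans (lebesgue_cube M); apply: le_measure => //; rewrite inE.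
  exact: compact_measurable_rV.
exact: measurable_cube.
Qed.

Lemma continuous_L1loc (f : 'rV[R]_n -> R) : continuous f -> L1loc f.
Proof.
move=> cf; split; first exact: continuous_measurable_rV.
move=> K cK.
have mK := compact_measurable_rV cK.
have : compact (f @` K) by apply: continuous_compact => //; exact:
    continuous_subspaceT.
move=> /compact_bounded[M [_ HM]].
apply: (@le_lt_trans _ _ (\int[lebesgue_rV]_(x in K) (M + 1)%:E)%E).
  apply: ge0_le_integral => //.
  - apply/measurable_EFinP; apply: measurable_funTS.
    by apply: measurableT_comp => //; exact: continuous_measurable_rV.
  - move=> x Kx; rewrite lee_fin.
    by apply: HM; [rewrite ltrDl|exists x].
rewrite integral_cst//.
have H (y : \bar R) : (0 <= y -> y < +oo -> (M + 1)%:E * y < +oo)%E.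
  by case: y => // r _ _; rewrite -EFinM ltry.
exact: H (lebesgue_compact cK).
Qed.
End topology_rV.

(** * Test functions *)

Section derivative_line.
Context {R : realType} {V : normedModType R}.
Implicit Types (f : V -> R) (v a : V).

(** Both difference quotients are the same function of the increment. This carries one-variable
    results, such as the mean value theorem, to directional derivatives. *)
Lemma is_derive_line f v a (t d : R) :
  is_derive t (1 : R) (fun s => f (s *: v + a)) d <-> is_derive (t *: v + a) v
      f d.
Proof.
have E : (fun h : R => h^-1 *: (((fun s => f (s *: v + a)) \o shift t) (h *:
    (1:R)) - f (t *: v + a))) =
         (fun h : R => h^-1 *: ((f \o shift (t *: v + a)) (h *: v) - f (t *: v
             + a))).
  by apply/funext => h /=; rewrite /shift/= [h *: 1]mulr1 scalerDl addrA.
have D : derivable (fun s : R => f (s *: v + a)) t (1 : R) = derivable f (t *: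
    v + a) v.
  by rewrite /derivable E.
have D' : 'D_(1 : R) (fun s : R => f (s *: v + a)) t = 'D_v f (t *: v + a).
  by rewrite /derive E.
split=> -[dl el].
  by split; [rewrite -D|rewrite -D'].
by split; [rewrite D|rewrite D'].
Qed.
End derivative_line.

Section tensor.
Context {R : realType} {n : nat}.
Implicit Types (f : 'I_n -> R -> R) (i : 'I_n) (x : 'rV[R]_n).

Definition tensor f x := \prod_i f i (x ord0 i).

Definition tensor_derive i f := fun j => if j == i then derive1 (f j) else f j.

Lemma tensor_is_derive i f x : (forall j, smooth1 (f j)) ->
  is_derive x (delta_mx ord0 i) (tensor f) (tensor (tensor_derive i f) x).
Proof.
move=> sf.
pose c := \prod_(j | j != i) f j (x ord0 j).
have -> : tensor (tensor_derive i f) x = c * derive1 (f i) (x ord0 i).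
  rewrite /tensor (bigD1 i)//= /tensor_derive eqxx mulrC; congr (_ * _).
  by apply: eq_bigr => j /negbTE ->.
have E h : tensor f (h *: delta_mx ord0 i + x) = c * f i (h + x ord0 i).
  rewrite /tensor (bigD1 i)//= mulrC !mxE !eqxx mulr1; congr (_ * _).
  by apply: eq_bigr => j /negbTE ji; rewrite !mxE ji andbF mulr0 add0r.
have [/= H1 H2] : is_derive (x ord0 i) 1 (fun y => c * f i y) (c * derive1 (f
    i) (x ord0 i)).
  apply: is_deriveZl; rewrite derive1E; apply: derivableP.
  exact: smooth1_derivable.
have F : (fun h : R => h^-1 *: ((tensor f \o shift x) (h *: delta_mx ord0 i) -
    tensor f x)) =
  (fun h : R => h^-1 *: (((fun y => c * f i y) \o shift (x ord0 i)) (h *: (1 :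
      R)) - c * f i (x ord0 i))).
  apply/funext => h /=; rewrite E; congr (_ *: (_ * f i (_ + _) - _)).
    by rewrite /GRing.scale/= mulr1.
  by have := E 0; rewrite scale0r !add0r.
by split; rewrite /derivable /derive F.
Qed.

Lemma tensor_continuous f : (forall j, continuous (f j)) -> continuous (tensor
    f).
Proof.
move=> cf; rewrite /tensor; elim: (index_enum _) => [|j s ih] x.
  under eq_fun do rewrite big_nil.
  exact: cst_continuous.
under eq_fun do rewrite big_cons.
apply: continuousM; last exact: ih.
apply: (@continuous_comp _ _ _ (fun x : 'rV[R]_n => x ord0 j) (f j)).
  exact: coord_continuous.
exact: cf.
Qed.

(** A partial derivative of a tensor product is again a tensor product of smooth factors, so the
    induction on [s] runs over an existential family of factors. *)
Lemma tensor_smooth f : (forall j, smooth1 (f j)) -> smooth (tensor f).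
Proof.
move=> sf s.
have [f' [sf' ->]] : exists f', (forall j, smooth1 (f' j)) /\
    foldr partial (tensor f) s = tensor f'.
  elim: s => [|i s [f' [sf' E]]]; first by exists f.
  exists (tensor_derive i f'); split.
    move=> j; rewrite /tensor_derive; case: ifP => // _.
    exact: smooth1_derive.
  apply/funext => x; rewrite /= E /partial.
  by have [_ ->] := tensor_is_derive i x sf'.
split.
  by apply: tensor_continuous => j; exact: smooth1_continuous.
by move=> i x; have [] := tensor_is_derive i x sf'.
Qed.

End tensor.

Section test_functions.
Context {R : realType} {n : nat}.
Implicit Types (f : 'I_n -> R -> R) (i : 'I_n) (x : 'rV[R]_n) (phi u :
    'rV[R]_n -> R).
Local Notation mu := (@lebesgue_rV R n).

Lemma supp_compact phi M : (forall x, phi x != 0 -> cube M x) ->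
  compact (closure [set x | phi x != 0]).
Proof.
move=> H; have cc : closed (@cube R n M).
  by apply: compact_closed; [exact: norm_hausdorff|exact: compact_cube].
apply: (subclosed_compact _ (@compact_cube R n M)); first exact: closed_closure.
by rewrite [X in _ `<=` X]((closure_id _).1 cc); exact: closure_subset.
Qed.

Lemma test_function_supp phi : test_function phi ->
  exists M, closure [set x | phi x != 0] `<=` cube M.
Proof. by move=> [_ /compact_cubeP]. Qed.

Lemma test_function_cube phi : test_function phi ->
  exists M, forall x, phi x != 0 -> cube M x.
Proof.
move=> /test_function_supp[M HM]; exists M => x px.
by apply: HM; exact: subset_closure.
Qed.

Lemma test_function_continuous phi : test_function phi -> continuous phi.
Proof. by move=> [/(_ [::])[]]. Qed.

Lemma test_function_derivable phi i x : test_function phi ->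
  derivable phi x (delta_mx ord0 i).
Proof. by move=> [/(_ [::])[]]. Qed.

Lemma smooth_partial phi i : smooth phi -> smooth (partial i phi).
Proof. by move=> sphi s; have := sphi (rcons s i); rewrite foldr_rcons. Qed.

(** Off the closed support of [phi] the function vanishes in a whole neighbourhood, so its partial
    derivative vanishes there too and the support does not grow. *)
Lemma test_function_partial phi i : test_function phi -> test_function
    (partial i phi).
Proof.
move=> tphi; split; first by apply: smooth_partial; case: tphi.
have [M HM] := test_function_supp tphi.
apply: (@supp_compact _ M) => x; apply: contraNP => nx; apply/eqP.
have : (~` closure [set x | phi x != 0]) x by move=> /HM.
move=> Cx; have : \forall y \near x, phi y = 0.
  have : nbhs x (~` closure [set x | phi x != 0]).
    apply: open_nbhs_nbhs; split => //; apply: closed_openC; exact: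
        closed_closure.
  apply: filterS => y ny; apply/eqP; apply: contrapT => /negP py; apply: ny.
  exact: subset_closure.
move=> near0; rewrite /partial.
have : is_derive x (delta_mx ord0 i) phi 0.
  apply: (@near_eq_is_derive _ _ _ (cst 0)).
  by apply: filterS near0 => y ->.
by case.
Qed.

Lemma continuous_supp_bounded phi M : continuous phi ->
  (forall x, phi x != 0 -> cube M x) -> exists2 C : R, 0 < C & forall x, `|phi
      x| <= C.
Proof.
move=> cphi sphi.
have : compact (phi @` cube M).
  by apply: continuous_compact; [exact: continuous_subspaceT|exact:
      compact_cube].
move=> /compact_bounded[C [_ HC]]; exists (`|C| + 1); first by rewrite ltr_wpDl.
move=> x; have [->|px] := eqVneq (phi x) 0.
  by rewrite normr0 addr_ge0.
apply: HC; last by exists x => //; exact: sphi.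
by rewrite (le_lt_trans (ler_norm _))// ltrDl.
Qed.

Lemma L1loc_integrable u K : L1loc u -> compact K ->
  mu.-integrable K (EFin \o u).
Proof.
move=> [mu_ /(_ K)] H cK; apply/integrableP; split; last exact: H.
by apply/measurable_EFinP; exact: measurable_funTS.
Qed.

Lemma L1loc_mul_integrable u phi M : L1loc u -> continuous phi ->
  (forall x, phi x != 0 -> cube M x) ->
  mu.-integrable setT (fun x => (u x * phi x)%:E).
Proof.
move=> Lu cphi sphi; have [C C0 HC] := continuous_supp_bounded cphi sphi.
have /(integrable_mkcond _ (@measurable_cube R n M)) := L1loc_integrable Lu
    (@compact_cube R n M).
move=> /(@integrableZl _ _ _ _ _ measurableT C).
apply: le_integrable => //.
  apply/measurable_EFinP; apply: measurable_funM; first by case: Lu.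
  exact: continuous_measurable_rV.
move=> x _ /=; rewrite patchE; case: ifPn => xM.
  by rewrite /= lee_fin !normrM [leLHS]mulrC ler_wpM2r// (le_trans (HC x))//
      ler_norm.
have -> : phi x = 0.
  apply: contrapT => /eqP px; move: xM; rewrite notin_setE; apply; exact: sphi.
by rewrite mulr0 /= normr0 lee_fin.
Qed.

Lemma test_mul_integrable u phi : L1loc u -> test_function phi ->
  mu.-integrable setT (fun x => (u x * phi x)%:E).
Proof.
move=> Lu tphi; have [M sphi] := test_function_cube tphi.
apply: L1loc_mul_integrable sphi => //; exact: test_function_continuous.
Qed.

Definition bumpn (c : R) (a b : 'I_n -> R) := tensor (fun i => bump c (a i) (b
    i)).

Definition obox (a b : 'I_n -> R) : set 'rV[R]_n := [set x | forall i, a i < x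
    ord0 i < b i].

Lemma measurable_obox a b : measurable (obox a b).
Proof.
rewrite (_ : obox a b = [set x | forall i, `]a i, b i[%classic (x ord0 i)]).
  by apply: (@measurable_rV_box _ _ (fun i => `]a i, b i[%classic)) => i;
      exact: measurable_itv.
by apply/seteqP; split => x /= H i; have := H i; rewrite in_itv.
Qed.

Lemma bumpn_eq0 c a b x : ~ obox a b x -> bumpn c a b x = 0.
Proof.
move=> /existsNP[i /negP nx]; rewrite /bumpn /tensor (bigD1 i)//= bump_eq0//.
by rewrite mul0r.
Qed.

Lemma obox_cube a b : exists M, obox a b `<=` cube M.
Proof.
exists (\sum_i (`|a i| + `|b i|)) => x ax i; rewrite /= in_itv/=.
have /andP[ai bi] := ax i.
have H : `|a i| + `|b i| <= \sum_i (`|a i| + `|b i|).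
  rewrite (bigD1 i)//= lerDl sumr_ge0// => j _; exact: addr_ge0.
rewrite -ler_norml (le_trans _ H)//.
rewrite ler_norml; apply/andP; split.
  rewrite (le_trans _ (ltW ai))// lerNl (le_trans (ler_norm _))// normrN
      lerDl//.
by rewrite (le_trans (ltW bi))// (le_trans (ler_norm _))// lerDr.
Qed.

Lemma bumpn_test c a b : 0 < c -> test_function (bumpn c a b).
Proof.
move=> c0; split; first by apply: tensor_smooth => i; exact: smooth1_bump.
have [M HM] := obox_cube a b; apply: (@supp_compact _ M) => x px.
by apply: HM; apply: contrapT => /(bumpn_eq0 c)/eqP; exact/negP.
Qed.

Lemma bumpn_cvg a b x : bumpn k.+1%:R^-1 a b x @[k --> \oo] --> (\1_(obox a b)
    x : R).
Proof.
have -> : \1_(obox a b) x = \prod_i (if a i < x ord0 i < b i then 1 else 0) :>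
    R.
  rewrite indicE; have [|] := boolP (x \in obox a b).
    by rewrite inE => ax; rewrite big1// => i _; rewrite ax.
  rewrite notin_setE => /existsNP[i /negP/negbTE nx].
  by rewrite (bigD1 i)//= nx mul0r.
rewrite /bumpn /tensor; elim: (index_enum _) => [|j s ih].
  by under eq_fun do rewrite big_nil; rewrite big_nil; exact: cvg_cst.
under eq_fun do rewrite big_cons; rewrite big_cons.
by apply: cvgM => //; exact: bump_cvg.
Qed.

Lemma bumpn_ge0_le1 c a b x : 0 < c -> 0 <= bumpn c a b x <= 1.
Proof.
move=> c0; rewrite /bumpn /tensor; elim/big_rec: _ => [|i y _ /andP[y0 y1]].
  by rewrite ler01 lexx.
have /andP[z0 z1] := bump_ge0_le1 (a i) (b i) (x ord0 i) c0.
by rewrite mulr_ge0// mulr_ile1.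
Qed.

End test_functions.

(** * The fundamental lemma of the calculus of variations *)

Section fundamental_lemma.
Context {R : realType} {n : nat}.
Implicit Types (x : 'rV[R]_n) (phi u g : 'rV[R]_n -> R) (a b : 'I_n -> R).
Local Notation mu := (@lebesgue_rV R n).

Lemma oboxI a b a' b' : obox a b `&` obox a' b' =
  obox (fun i => Num.max (a i) (a' i)) (fun i => Num.min (b i) (b' i)).
Proof.
apply/seteqP; split => x /=.
  move=> [H H'] i; rewrite gt_max lt_min.
  by have /andP[-> ->] := H i; have /andP[-> ->] := H' i.
move=> H; split => i; have := H i; rewrite gt_max lt_min => /andP[/andP[? ?]
    /andP[? ?]];
  exact/andP.
Qed.

Definition oboxes : set_system 'rV[R]_n := [set B | exists a b, B = obox a b].

Lemma setI_closed_oboxes : setI_closed oboxes.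
Proof.
move=> _ _ [a [b ->]] [a' [b' ->]]; rewrite oboxI.
by do 2 eexists.
Qed.

(** It suffices to treat preimages of open intervals under one coordinate. Such a slab is the
    increasing union of boxes whose other sides are []-M, M[]. *)
Lemma measurable_rV_oboxes (A : set 'rV[R]_n) : measurable A -> <<s oboxes >> A.
Proof.
have sa := smallest_sigma_algebra [set: 'rV[R]_n] oboxes.
apply: smallest_sub => //.
rewrite -bigcup_seq => B [i _] [Y mY <-]; rewrite setTI.
have {}mY : (@RGenOpens.G R).-sigma.-measurable Y by rewrite
    -(RGenOpens.measurableE R).
move: Y mY; apply: (@smallest_sub _ (sigma_algebra setT) _
  [set Y | <<s oboxes >> ((fun x : 'rV[R]_n => x ord0 i) @^-1` Y)]).
  split => [|Y mY|F mF] /=.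
  - by rewrite preimage_set0; case: sa.
  - by rewrite setTD preimage_setC -setTD; case: sa => _ + _; apply.
  - by rewrite preimage_bigcup; case: sa => _ _; apply.
move=> _ [a [b ->]] /=.
have -> : (fun x : 'rV[R]_n => x ord0 i) @^-1` `]a, b[ =
  \bigcup_M obox (fun j => if j == i then a else - M%:R) (fun j => if j == i
      then b else M%:R).
  apply/seteqP; split => x /=; last first.
    by move=> [M _ /(_ i)]; rewrite eqxx in_itv.
  rewrite in_itv/= => xi.
  exists (Num.trunc (\sum_j `|x ord0 j|)).+1 => // j; case: eqP => [->//|_].
  rewrite -ltr_norml; apply: le_lt_trans (truncnS_gt _).
  by rewrite (bigD1 j)//= lerDl sumr_ge0.
case: sa => _ _; apply => M; apply: sub_sigma_algebra.
by do 2 eexists.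
Qed.

(** The measurable sets over which [h] integrates to 0 form a Dynkin system, the vanishing total
    integral giving stability under complements; boxes are closed under intersection and
    generate. *)
Lemma integral_oboxes_eq0 (h : 'rV[R]_n -> \bar R) : mu.-integrable setT h ->
  (\int[mu]_x h x = 0)%E ->
  (forall a b, \int[mu]_(x in obox a b) h x = 0)%E ->
  forall A, measurable A -> (\int[mu]_(x in A) h x = 0)%E.
Proof.
move=> ih h0 hb A mA.
pose D := [set A | measurable A /\ (\int[mu]_(x in A) h x = 0)%E].
suff : D A by case.
have dD : dynkin D.
  split; first by split.
    move=> B [mB B0]; split; first exact: measurableC.
    have : (\int[mu]_(x in B `|` ~` B) h x = 0)%E by rewrite setUv.
    rewrite integral_setU//; first by rewrite B0 add0e.
    - exact: measurableC.
    - by rewrite setUv; exact: (measurable_int mu).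
    - by apply/disj_setPS; rewrite setICr.
  move=> F tF mF; split; first by apply: bigcupT_measurable => i; case: (mF i).
  rewrite integral_bigcup//.
  - by rewrite eseries0// => i _ _; case: (mF i).
  - by move=> i; case: (mF i).
  - apply: integrableS ih => //; apply: bigcupT_measurable => i; by case: (mF
      i).
have : <<d oboxes >> A.
  by rewrite (setI_closed_g_dynkin_g_sigma_algebra setI_closed_oboxes); exact:
      measurable_rV_oboxes.
apply: smallest_sub => // _ [a [b ->]]; split; first exact: measurable_obox.
exact: hb.
Qed.

Lemma fundamental_lemma g : L1loc g ->
  (forall phi, test_function phi -> \int[mu]_x (g x * phi x)%:E = 0)%E ->
  {ae mu, forall x, g x = 0}.
Proof.
move=> Lg H.
(* The bumps on the box with [c = 1 / (k + 1)] tend to its indicator, and their products with [g]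
   are dominated by [|g|] restricted to a cube that contains the box. *)
have box0 a b : (\int[mu]_(x in obox a b) (g x)%:E = 0)%E.
  rewrite integral_mkcond/=.
  have [M HM] := obox_cube a b.
  have ig := L1loc_integrable Lg (@compact_cube R n M).
  have mg : measurable_fun setT g by case: Lg.
  have := @dominated_cvg _ _ _ mu setT measurableT
    (fun k x => (g x * bumpn k.+1%:R^-1 a b x)%:E)
    ((fun x => (g x)%:E) \_ (obox a b))
    (abse \o ((EFin \o g) \_ (cube M))).
  have -> : (fun k => \int[mu]_x (g x * bumpn k.+1%:R^-1 a b x)%:E)%E = cst 0%E.
    by apply/funext => k; rewrite H//; apply: bumpn_test; rewrite invr_gt0.
  move=> cvg0; have : ((cst 0 : nat -> \bar R) k @[k --> \oo] --> 
      \int[mu]_x ((fun x => (g x)%:E) \_ (obox a b)) x)%E.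
    apply: cvg0.
    - move=> k; apply/measurable_EFinP; apply: measurable_funM => //.
      apply: continuous_measurable_rV; apply: test_function_continuous.
      by apply: bumpn_test; rewrite invr_gt0.
    - move=> x _.
      have -> : ((fun x => (g x)%:E) \_ (obox a b)) x = (g x * \1_(obox a b)
          x)%:E.
        by rewrite patchE indicE; case: ifPn => _; rewrite ?mulr1// mulr0.
      apply: cvg_EFin; first by near=> k.
      by apply: cvgM; [exact: cvg_cst|exact: bumpn_cvg].
    - by move=> x _ /=; rewrite patchE; case: ifP.
    - apply: integrable_abse; apply/(integrable_mkcond _ (@measurable_cube R n
        M)).
      exact: ig.
    - move=> k x _ /=; rewrite patchE; case: ifPn => xM.
        rewrite lee_fin normrM ler_piMr// ger0_norm;
          by have /andP[] := @bumpn_ge0_le1 R n k.+1%:R^-1 a b x (ltac:(by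
              rewrite invr_gt0)).
      have -> : bumpn k.+1%:R^-1 a b x = 0.
        by apply: bumpn_eq0 => /HM; move: xM; rewrite notin_setE.
      by rewrite mulr0 normr0 lee_fin.
  by move/cvg_lim => <- //; rewrite lim_cst.
have Q M : {ae mu, forall x, cube M x -> g x = 0}.
  (* An open box around the closed cube: restricting [g] to it gives a globally integrable function
     whose integral over any box is again an integral of [g] over a box, the intersection. *)
  pose q : set 'rV[R]_n := obox (fun=> - (M + 1)) (fun=> M + 1).
  have [M' HM'] := @obox_cube R n (fun=> - (M + 1)) (fun=> M + 1).
  have iq : mu.-integrable q (EFin \o g).
    apply: (integrableS _ _ _ (L1loc_integrable Lg (@compact_cube R n M'))) =>
        //.
    - exact: measurable_cube.
    - exact: measurable_obox.
  have ih : mu.-integrable setT ((EFin \o g) \_ q).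
    by apply/(integrable_mkcond _ (@measurable_obox _ _ _ _)).
  have all0 A : measurable A -> (\int[mu]_(x in A) ((EFin \o g) \_ q) x = 0)%E.
    apply: integral_oboxes_eq0 => //.
      by rewrite -integral_mkcond; exact: box0.
    by move=> a b; rewrite -integral_mkcondr oboxI; exact: box0.
  have : ae_eq mu setT ((EFin \o g) \_ q) (cst 0%E).
    apply: integral_ae_eq => // E _ mE.
    by rewrite all0// integral_cst// mul0e.
  apply: filterS => x /= H0 xM; have := H0 I; rewrite patchE mem_set.
    by case.
  move=> i /=; have := xM i; rewrite /= in_itv/= => /andP[h1 h2].
  by rewrite (lt_le_trans _ h1) ?(le_lt_trans h2)// ?ltrDl// ltrN2 ltrDl.
have : {ae mu, forall x, forall k : nat, cube k%:R x -> g x = 0}.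
  by apply: ae_foralln => k; exact: Q.
apply: filterS => x /(_ (Num.trunc (\sum_j `|x ord0 j|)).+1); apply.
move=> j; rewrite /= in_itv/= -ler_norml; apply: ltW; apply: le_lt_trans
    (truncnS_gt _).
by rewrite (bigD1 j)//= lerDl sumr_ge0.
Unshelve. all: by end_near. Qed.

End fundamental_lemma.

(** * Behaviour of Lebesgue measure under similarities *)

Section change_of_variables.
Context {R : realType} {n : nat}.
Implicit Types (x : 'rV[R]_n) (T : 'rV[R]_n -> 'rV[R]_n) (a b : 'I_n -> R).
Local Notation mu := (@lebesgue_rV R n).

Lemma lebesgue_obox a b : mu (obox a b) = (\prod_i Num.max (b i - a i) 0)%:E.
Proof.
rewrite (_ : obox a b = [set x | forall i, `]a i, b i[%classic (x ord0 i)]);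
    last first.
  by apply/seteqP; split => x /= H i; have := H i; rewrite in_itv.
rewrite (lebesgue_rV_box (A := fun i => `]a i, b i[%classic)); last by move=>
    i; exact: measurable_itv.
rewrite (big_morph EFin (fun y z : R => EFinM y z) (erefl _)).
apply: eq_bigr => i _; rewrite lebesgue_measure_itv/= lte_fin.
case: ifPn => ab; first by rewrite max_l// subr_ge0 ltW.
by rewrite max_r// subr_le0 leNgt.
Qed.

(** The pushforward of [mu] under [T] is [c] times [mu]. As preimages are measured, [c] is the
    inverse of the Jacobian: [s ^- n] for a similarity of ratio [s]. *)
Definition scales T (c : R) : Prop := [/\ measurable_fun setT T, 0 < c &
  forall A : set 'rV[R]_n, measurable A -> mu (T @^-1` A) = (c%:E * mu A)%E].

(** Boxes form a generating pi-system and the cubes []-k, k[^n] exhaust the space with finite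
    measure, so the pushforward and the multiple of [mu] agree by uniqueness of measures. *)
Lemma scales_obox T (c : R) : measurable_fun setT T -> 0 < c ->
  (forall a b, mu (T @^-1` (obox a b)) = c%:E * mu (obox a b))%E -> scales T c.
Proof.
move=> mT c0 H; split => // A mA.
pose m1 : {measure set 'rV[R]_n -> \bar R} :=
  measure_function_pushforward__canonical__measure_function_Measure mu mT.
pose m2 : {measure set 'rV[R]_n -> \bar R} := mscale (NngNum (ltW c0)) mu.
have := @measure_unique _ R _ (@oboxes R n) (fun k => obox (fun=> - k%:R)
    (fun=> k%:R)) _ (@setI_closed_oboxes R n) _ _ m1 m2 _ _ A mA.
apply.
- apply/seteqP; split => [B mB|B]; first exact: measurable_rV_oboxes.
  apply: smallest_sub; first exact: sigma_algebra_measurable.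
  by move=> _ [a [b ->]]; exact: measurable_obox.
- by move=> i; do 2 eexists.
- rewrite -subTset => x _.
  exists (Num.trunc (\sum_j `|x ord0 j|)).+1 => // j.
  rewrite -ltr_norml; apply: le_lt_trans (truncnS_gt _).
  by rewrite (bigD1 j)//= lerDl sumr_ge0.
- by move=> _ [a [b ->]]; exact: H.
- by move=> k; have := H (fun=> - k%:R) (fun=> k%:R); rewrite lebesgue_obox
    -EFinM => E; rewrite [ltLHS]E ltry.
Qed.

Lemma scales_comp T T' c c' : scales T c -> scales T' c' -> scales (T \o T')
    (c' * c).
Proof.
move=> [mT c0 H] [mT' c'0 H']; split; first exact: measurableT_comp.
- exact: mulr_gt0.
- move=> A mA; rewrite comp_preimage H'; last by rewrite -[X in measurable
    X]setTI; exact: mT.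
  by rewrite H// EFinM muleA.
Qed.

Lemma scales_ge0_integral T c (f : 'rV[R]_n -> \bar R) : scales T c ->
  measurable_fun setT f -> (forall x, 0 <= f x)%E ->
  (\int[mu]_x f (T x) = c%:E * \int[mu]_x f x)%E.
Proof.
move=> [mT c0 H] mf f0.
pose m1 : {measure set 'rV[R]_n -> \bar R} :=
  measure_function_pushforward__canonical__measure_function_Measure mu mT.
pose m2 : {measure set 'rV[R]_n -> \bar R} := mscale (NngNum (ltW c0)) mu.
transitivity (\int[m1]_x f x)%E.
  rewrite /m1 /= (ge0_integral_pushforward mT)//.
transitivity (\int[m2]_x f x)%E.
  by apply: eq_measure_integral => A mA _; exact: H.
exact: ge0_integral_mscale.
Qed.

(** A finite positive factor [c] keeps infinite positive and negative parts infinite, so the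
    identity extends from nonnegative to all measurable functions, even when both parts are
    infinite. *)
Lemma scales_integral T c (f : 'rV[R]_n -> \bar R) : scales T c ->
  measurable_fun setT f ->
  (\int[mu]_x f (T x) = c%:E * \int[mu]_x f x)%E.
Proof.
move=> sT mf; have [_ c0 _] := sT.
rewrite [LHS]integralE [in RHS]integralE.
have -> : (\int[mu]_x (fun x => f (T x))^\+ x = c%:E * \int[mu]_x f^\+ x)%E.
  rewrite -(scales_ge0_integral sT (measurable_funepos mf)); last by move=> x;
      exact: funepos_ge0.
  by apply: eq_integral => x _; rewrite !funeposE.
have -> : (\int[mu]_x (fun x => f (T x))^\- x = c%:E * \int[mu]_x f^\- x)%E.
  rewrite -(scales_ge0_integral sT (measurable_funeneg mf)); last by move=> x;
      exact: funeneg_ge0.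
  by apply: eq_integral => x _; rewrite !funenegE.
have : (0 <= \int[mu]_x f^\+ x)%E by exact: integral_ge0.
have : (0 <= \int[mu]_x f^\- x)%E by exact: integral_ge0.
move: (\int[mu]_x f^\+ x)%E (\int[mu]_x f^\- x)%E => [p||] [q||]//= _ _.
- by rewrite -EFinM -!EFinD -EFinM mulrBr.
- by rewrite -EFinM gt0_muley ?lte_fin// addeNy// addeNy gt0_muleNy ?lte_fin.
- by rewrite gt0_muley ?lte_fin// !addye// gt0_muley ?lte_fin.
- by rewrite gt0_muley ?lte_fin// gt0_muleNy ?lte_fin.
Qed.

Lemma measurable_mulmx_add (A : 'M[R]_n) (v : 'rV[R]_n) :
  measurable_fun setT (fun x : 'rV[R]_n => x *m A + v).
Proof.
apply/measurable_fun_rVP => i.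
rewrite (_ : (fun x => _) = fun x : 'rV[R]_n => \sum_j x ord0 j * A j i + v
    ord0 i).
  apply: measurable_funD => //; apply: measurable_sum => j.
  by apply: measurable_funM => //; exact: measurable_coord_rV.
by apply/funext => x; rewrite !mxE.
Qed.

Lemma scales_homothety (s : R) (v : 'rV[R]_n) : 0 < s ->
  scales (fun x => x *m s%:M + v) (s ^- n).
Proof.
move=> s0; apply: scales_obox.
- exact: measurable_mulmx_add.
- by rewrite invr_gt0 exprn_gt0.
move=> a b.
have -> : (fun x => x *m s%:M + v) @^-1` obox a b =
  obox (fun i => s^-1 * (a i - v ord0 i)) (fun i => s^-1 * (b i - v ord0 i)).
  have E1 (y z w : R) : (s^-1 * (y - w) < z) = (y < s * z + w).
    by rewrite mulrC ltr_pdivrMr// [z * s]mulrC ltrBlDr.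
  have E2 (y z w : R) : (z < s^-1 * (y - w)) = (s * z + w < y).
    by rewrite mulrC ltr_pdivlMr// [z * s]mulrC ltrBrDr.
  by apply/seteqP; split => x /= H i; have := H i; rewrite mul_mx_scalar !mxE
      E1 E2.
rewrite !lebesgue_obox -EFinM; congr EFin.
rewrite (_ : s ^- n = \prod_(i < n) s^-1); last by rewrite prodr_const
    card_ord exprVn.
rewrite -big_split/=; apply: eq_bigr => i _.
rewrite -mulrBr opprB addrA subrK [RHS]maxr_pMr ?invr_ge0 ?(ltW s0)//.
by rewrite mulr0.
Qed.

Lemma scales_translation (v : 'rV[R]_n) : scales (fun x => x + v) 1.
Proof.
have := scales_homothety v ltr01; rewrite expr1n invr1.
by under eq_fun do rewrite mul_mx_scalar scale1r.
Qed.

Lemma scales_reflection (v : 'rV[R]_n) : scales (fun x => v - x) 1.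
Proof.
apply: scales_obox => //.
  have := @measurable_mulmx_add (- 1%:M) v.
  by under eq_fun do rewrite mulmxN mulmx1 addrC.
move=> a b.
have -> : (fun x => v - x) @^-1` obox a b =
  obox (fun i => v ord0 i - b i) (fun i => v ord0 i - a i).
  by apply/seteqP; split => x /= H i; have := H i; rewrite !mxE => /andP[h1 h2];
    rewrite ltrBlDr -ltrBlDl -ltrBrDl; apply/andP; split; lra.
rewrite !lebesgue_obox -EFinM mul1r; congr EFin; apply: eq_bigr => i _.
by congr Num.max; lra.
Qed.

(** The uniqueness argument for Haar measure: the left side is the double integral of
    [\1_A x * \1_B (y *m L)], and Tonelli together with translations and one reflection exchanges
    the roles of [A] and [B]. Applied to a set that [L] leaves invariant, it shows that [L]
    preserves [mu] without any determinant. *)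
Lemma haar (L L' : 'M[R]_n) (A B : set 'rV[R]_n) : L' *m L = 1%:M ->
  measurable A -> measurable B ->
  (mu A * mu ((fun x => x *m L) @^-1` B) = mu ((fun x => x *m L) @^-1` A) * mu
      B)%E.
Proof.
move=> LL mA mB.
have mL : measurable_fun setT (fun x : 'rV[R]_n => x *m L).
  by have := @measurable_mulmx_add L 0; under eq_fun do rewrite addr0.
have mLA C : measurable C -> measurable ((fun x : 'rV[R]_n => x *m L) @^-1` C).
  by move=> mC; rewrite -[X in measurable X]setTI; exact: mL.
have mind (C : set 'rV[R]_n) : measurable C -> measurable_fun setT (\1_C :
    'rV[R]_n -> R).
  by move=> mC; exact: measurable_indic.
have intE (C D : set 'rV[R]_n) : measurable C -> measurable D ->
  (mu C * mu D = \int[mu]_y \int[mu]_x (\1_C x * \1_D y)%:E)%E.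
  move=> mC mD; transitivity (\int[mu]_y (mu C * (\1_D y)%:E))%E.
    rewrite ge0_integralZl//; last first.
      by apply/measurable_EFinP; exact: mind.
    by rewrite integral_indic// setIT.
  apply: eq_integral => y _.
  under eq_integral do rewrite EFinM muleC.
  rewrite ge0_integralZl ?lee_fin//; last by apply/measurable_EFinP; exact:
      mind.
  by rewrite integral_indic// setIT muleC.
have m2 (C D : set 'rV[R]_n) (f g : 'rV[R]_n * 'rV[R]_n -> 'rV[R]_n) :
    measurable C -> measurable D ->
    measurable_fun setT f -> measurable_fun setT g ->
    measurable_fun setT (fun z => (\1_C (f z) * \1_D (g z))%:E : \bar R).
  move=> mC mD mf mg; apply/measurable_EFinP; apply: measurable_funM.
    by apply: (measurableT_comp (mind _ mC)).
  by apply: (measurableT_comp (mind _ mD)).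
have m1 (C D : set 'rV[R]_n) (f g : 'rV[R]_n -> 'rV[R]_n) : measurable C ->
    measurable D ->
    measurable_fun setT f -> measurable_fun setT g ->
    measurable_fun setT (fun z => (\1_C (f z) * \1_D (g z))%:E : \bar R).
  move=> mC mD mf mg; apply/measurable_EFinP; apply: measurable_funM.
    by apply: (measurableT_comp (mind _ mC)).
  by apply: (measurableT_comp (mind _ mD)).
have mD (f g : 'rV[R]_n * 'rV[R]_n -> 'rV[R]_n) : measurable_fun setT f ->
    measurable_fun setT g ->
   measurable_fun setT (fun z => f z + g z).
  move=> /measurable_fun_rVP mf /measurable_fun_rVP mg;
      apply/measurable_fun_rVP => i.
  under eq_fun do rewrite mxE.
  exact: measurable_funD.
have mN (f : 'rV[R]_n * 'rV[R]_n -> 'rV[R]_n) : measurable_fun setT f ->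
   measurable_fun setT (fun z => - f z).
  move=> /measurable_fun_rVP mf; apply/measurable_fun_rVP => i.
  under eq_fun do rewrite mxE.
  exact: measurableT_comp.
have mL1 : measurable_fun setT (fun z : 'rV[R]_n * 'rV[R]_n => z.1 *m L).
  exact: (measurableT_comp mL measurable_fst).
have mL2 : measurable_fun setT (fun z : 'rV[R]_n * 'rV[R]_n => z.2 *m L).
  exact: (measurableT_comp mL measurable_snd).
rewrite intE//; last exact: mLA.
transitivity (\int[mu]_y \int[mu]_x (\1_A (x + y *m L) * \1_B (y *m L))%:E)%E.
  apply: eq_integral => y _.
  have := scales_integral (f := fun x => (\1_A x * \1_B (y *m L))%:E)
      (scales_translation (y *m L)).
  by rewrite mul1e => -> //; apply: m1.
rewrite (@fubini_tonelli _ _ _ _ R mu mu (fun z => (\1_A (z.2 + z.1 *m L) *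
    \1_B (z.1 *m L))%:E)) //=; last first.
  apply: (m2 A B (fun z => z.2 + z.1 *m L) (fun z => z.1 *m L)) => //.
  exact: (mD snd (fun z => z.1 *m L)).
(* Here [y] is translated by [- (x *m L')], which changes [y *m L] into [y *m L - x] because
   [L' *m L = 1]. *)
transitivity (\int[mu]_x \int[mu]_y (\1_A (y *m L) * \1_B (y *m L - x))%:E)%E.
  apply: eq_integral => x _.
  have := scales_integral (f := fun y => (\1_A (x + y *m L) * \1_B (y *m L))%:E)
    (scales_translation (- (x *m L'))).
  rewrite mul1e => <-; last first.
    apply: m1 => //.
    by have := @measurable_mulmx_add L x; under eq_fun do rewrite addrC.
  apply: eq_integral => y _.
  by rewrite mulmxDl mulNmx -mulmxA LL mulmx1 addrCA subrr addr0.
rewrite (@fubini_tonelli _ _ _ _ R mu mu (fun z => (\1_A (z.2 *m L) * \1_B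
    (z.2 *m L - z.1))%:E)) //=; last first.
  apply: (m2 A B (fun z => z.2 *m L) (fun z => z.2 *m L - z.1)) => //.
  by apply: (mD (fun z => z.2 *m L) (fun z => - z.1)) => //; exact: (mN fst).
rewrite [RHS]muleC (intE B _ mB (mLA _ mA)).
apply: eq_integral => y _.
have := scales_integral (f := fun x => (\1_A (y *m L) * \1_B x)%:E)
    (scales_reflection (y *m L)).
by rewrite mul1e => ->; [apply: eq_integral => x _; rewrite mulrC|apply: m1].
Qed.

Lemma edotE (x y : 'rV[R]_n) : edot x y = (x *m y^T) ord0 ord0.
Proof. by rewrite mxE; apply: eq_bigr => i _; rewrite mxE. Qed.

Lemma continuous_enorm : continuous (@enorm R n).
Proof.
have cs (s : seq 'I_n) : continuous (fun x : 'rV[R]_n => \sum_(i <- s) x ord0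
    i ^+ 2).
  elim: s => [|j s ih] x.
    by under eq_fun do rewrite big_nil; exact: cst_continuous.
  under eq_fun do rewrite big_cons.
  apply: (@continuousD _ _ _ (fun x : 'rV[R]_n => x ord0 j ^+ 2)); last exact:
      ih.
  apply: (@continuous_comp _ _ _ (fun x : 'rV[R]_n => x ord0 j) (fun y => y ^+
      2)).
    exact: coord_continuous.
  exact: exprn_continuous.
move=> x; apply: (@continuous_comp _ _ _ (fun x : 'rV[R]_n => \sum_i x ord0 i
    ^+ 2) Num.sqrt).
  exact: cs.
exact: sqrt_continuous.
Qed.

Lemma enorm_coord (x : 'rV[R]_n) i : `|x ord0 i| <= enorm x.
Proof.
rewrite -sqrtr_sqr ler_sqrt ?sumr_ge0// => [|j _]; last exact: sqr_ge0.
by rewrite (bigD1 i)//= lerDl sumr_ge0// => j _; exact: sqr_ge0.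
Qed.

(** The Euclidean unit ball is invariant under [L], and its measure is positive and finite, so it
    cancels from the identity of [haar]. *)
Lemma scales_orthogonal (L : 'M[R]_n) : L *m L^T = 1%:M ->
  scales (fun x => x *m L) 1.
Proof.
move=> LL; have LL' := mulmx1C LL.
have mL : measurable_fun setT (fun x : 'rV[R]_n => x *m L).
  by have := @measurable_mulmx_add L 0; under eq_fun do rewrite addr0.
split => // A mA; rewrite mul1e.
pose B : set 'rV[R]_n := [set x | enorm x <= 1].
have mB : measurable B.
  have := continuous_measurable_rV continuous_enorm measurableT
      (measurable_itv `]-oo, (1:R)]).
  by rewrite setTI; congr measurable; apply/seteqP; split => x /=; rewrite
      in_itv.
have LB : (fun x => x *m L) @^-1` B = B.
  apply/seteqP; split => x /=; rewrite /B/= /enorm.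
    suff -> : \sum_i (x *m L) ord0 i ^+ 2 = \sum_i x ord0 i ^+ 2 by [].
    by have := edotE (x *m L) (x *m L); rewrite trmx_mul -mulmxA [L *m
        _]mulmxA LL mul1mx -edotE.
  suff -> : \sum_i (x *m L) ord0 i ^+ 2 = \sum_i x ord0 i ^+ 2 by [].
  by have := edotE (x *m L) (x *m L); rewrite trmx_mul -mulmxA [L *m _]mulmxA
      LL mul1mx -edotE.
have := @haar L L^T B A LL' mB mA; rewrite LB.
have B0 : (0 < mu B)%E.
  (* A box inside the ball: with half-side [1 / (n + 1)] the sum of the [n] squares is at most
     [n / (n + 1)]. *)
  apply: (@lt_le_trans _ _ (mu (obox (fun=> - n.+1%:R^-1) (fun=> n.+1%:R^-1)))).
    rewrite lebesgue_obox lte_fin; apply: prodr_gt0 => i _.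
    by rewrite lt_max opprK addr_gt0// invr_gt0.
  apply: le_measure; rewrite ?inE//; first exact: measurable_obox.
  move=> x /= xB; rewrite /B/= /enorm -(sqrtr1 R) ler_sqrt//.
  apply: (@le_trans _ _ (\sum_(i < n) n.+1%:R^-1)).
    apply: ler_sum => i _; have := xB i; rewrite -ltr_norml => /ltW xi.
    rewrite -real_normK ?num_real// expr2.
    rewrite (le_trans (ler_pM _ _ xi xi))// ler_piMr ?invr_ge0// invf_le1//
        ler1n//.
  rewrite sumr_const card_ord -[_ *+ n]mulr_natl ler_pdivrMr// mul1r ler_nat//.
have Boo : (mu B < +oo)%E.
  apply: le_lt_trans (@lebesgue_cube R n 1); apply: le_measure; rewrite ?inE//.
    exact: measurable_cube.
  move=> x /= xB i; rewrite /= in_itv/= -ler_norml.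
  exact: le_trans (enorm_coord _ _) xB.
move: (mu B) B0 Boo => [r||]//; rewrite lte_fin => r0 _ E.
have := congr1 (fun z => (r^-1)%:E * z)%E E.
by rewrite !muleA -EFinM mulVf ?gt_eqF// !mul1e.
Qed.

Lemma scales_similarity (L : 'M[R]_n) (s : R) (v : 'rV[R]_n) : 0 < s ->
  L *m L^T = (s ^+ 2)%:M -> scales (fun x => x *m L + v) (s ^- n).
Proof.
move=> s0 LL.
have := scales_comp (scales_homothety v s0) (@scales_orthogonal (s^-1 *: L) _).
rewrite mul1r.
rewrite (_ : _ \o _ = (fun x => x *m L + v)); last first.
  apply/funext => x /=; rewrite -mulmxA mul_mx_scalar scalerA divff ?gt_eqF//.
  by rewrite scale1r.
apply; rewrite linearZ/= -scalemxAl -scalemxAr LL !scale_scalar_mx.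
by congr (_%:M); field; rewrite gt_eqF.
Qed.

End change_of_variables.

(** * Chain rule and translation of test functions *)

Section directional_derivatives.
Context {R : realType} {V : normedModType R}.
Implicit Types (f : V -> R) (v w x : V).

Lemma mvt_segment (f df : R -> R) (h : R) :
  (forall t : R, is_derive t 1 f (df t)) -> h != 0 ->
  exists2 t, `|t| <= `|h| & f h - f 0 = df t * h.
Proof.
move=> fd; have cf a b : {within `[a, b], continuous f}.
  apply: derivable_within_continuous => t _; exact: ex_derive.
rewrite neq_lt => /orP[h0|h0].
- have [t + E] := @MVT R f df h 0 h0 (fun t _ => fd t) (cf _ _).
  rewrite in_itv/= => /andP[ht t0]; exists t.
    by rewrite !ltr0_norm// lerN2 ltW.
  by rewrite -opprB E sub0r mulrN opprK.
- have [t + E] := @MVT R f df 0 h h0 (fun t _ => fd t) (cf _ _).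
  rewrite in_itv/= => /andP[t0 ht]; exists t.
    by rewrite !gtr0_norm// ltW.
  by rewrite E subr0.
Qed.

Lemma is_derive_scale f c v x : derivable f x v ->
  is_derive x (c *: v) f (c * 'D_v f x).
Proof.
move=> dfx.
have H0 : is_derive (0 : R) 1 (fun s : R => f (s *: v + x)) ('D_v f x).
  by apply/is_derive_line; rewrite scale0r add0r; exact: derivableP.
have -> : x = (0 : R) *: (c *: v) + x by rewrite scale0r add0r.
apply/is_derive_line; rewrite scale0r add0r.
have -> : (fun s : R => f (s *: (c *: v) + x)) =
    (fun s : R => f (s *: v + x)) \o (fun s => c * s).
  by apply/funext => s /=; rewrite scalerA mulrC.
rewrite mulrC; apply: is_derive1_comp; first by rewrite mulr0.
by rewrite -[c in X in is_derive _ _ _ X]mulr1; exact: (is_deriveZl c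
    (is_derive_id _ _)).
Qed.

(** The increment along [v + w] is split at [h *: w + x]. The part along [v] is handled by the mean
    value theorem and continuity of ['D_v f], the part along [w] by derivability at [x] alone; this
    asymmetry lets directions be added one at a time. *)
Lemma is_derive_add f v w x : (forall y, derivable f y v) ->
  continuous ('D_v f) -> derivable f x w ->
  is_derive x (v + w) f ('D_v f x + 'D_w f x).
Proof.
move=> dv cv dw.
suff H : h^-1 *: ((f \o shift x) (h *: (v + w)) - f x) @[h --> 0^'] --> 'D_v f
    x + 'D_w f x.
  by split; [apply/cvg_ex; eexists; exact: H|exact/cvg_lim].
have -> : (fun h : R => h^-1 *: ((f \o shift x) (h *: (v + w)) - f x)) =
  (fun h : R => h^-1 *: (f (h *: v + (h *: w + x)) - f (h *: w + x)) +
    h^-1 *: ((f \o shift x) (h *: w) - f x)).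
  apply/funext => h /=; rewrite -scalerDr; congr (_ *: _).
  by rewrite addrA subrK scalerDr addrA.
apply: cvgD; last exact: dw.
apply/cvgrPdist_le => e e0.
have /cvgrPdist_le/(_ e e0)/nbhs_ballP[d d0 Hd] := cv x.
have M0 : 0 < `|v| + `|w| + 1 by rewrite ltr_wpDl// addr_ge0.
near=> h.
have h0 : h != 0 by near: h; exact: nbhs_dnbhs_neq.
have [t th E] := @mvt_segment (fun s : R => f (s *: v + (h *: w + x)))
  (fun s => 'D_v f (s *: v + (h *: w + x))) h
  (fun t => (is_derive_line f v (h *: w + x) t _).2 (derivableP (dv _))) h0.
rewrite scale0r add0r in E; rewrite E /GRing.scale/= mulrC mulfK//.
apply: Hd; rewrite -ball_normE/=.
have -> : x - (t *: v + (h *: w + x)) = - (t *: v + h *: w).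
  by rewrite addrA opprD addrCA subrr addr0.
rewrite normrN (le_lt_trans (ler_normD _ _))// !normrZ.
apply: (@le_lt_trans _ _ (`|h| * (`|v| + `|w| + 1))).
  by rewrite !mulrDr mulr1 ler_wpDr// lerD2r ler_wpM2r.
rewrite -ltr_pdivlMr//; near: h.
by apply: dnbhs0_lt; rewrite divr_gt0// ltr_wpDl// addr_ge0.
Unshelve. all: by end_near. Qed.

End directional_derivatives.

Section chain_rule.
Context {R : realType} {n : nat}.
Implicit Types (x v b : 'rV[R]_n) (f g phi : 'rV[R]_n -> R) (A : 'M[R]_n).

Lemma is_derive_partials f v x :
  (forall i y, derivable f y (delta_mx ord0 i)) ->
  (forall i, continuous (partial i f)) ->
  is_derive x v f (\sum_i v ord0 i * partial i f x).
Proof.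
move=> df cf.
have : forall s : seq 'I_n, is_derive x (\sum_(i <- s) v ord0 i *: delta_mx
    ord0 i) f
     (\sum_(i <- s) v ord0 i * partial i f x).
  elim=> [|i s ih].
    rewrite !big_nil; have := @is_derive_scale _ _ f 0 0 x.
    rewrite scale0r mul0r; apply.
    rewrite /derivable; under eq_fun do rewrite scaler0 /= add0r subrr scaler0.
    exact: is_cvg_cst.
  rewrite !big_cons.
  have H y := @is_derive_scale _ _ f (v ord0 i) (delta_mx ord0 i) y (df i y).
  have E y : 'D_(v ord0 i *: delta_mx ord0 i) f y = v ord0 i * partial i f y
      by have [_ ->] := H y.
  rewrite -E; have [dih <-] := ih.
  have cD : continuous ('D_(v ord0 i *: delta_mx ord0 i) f).
    rewrite (_ : 'D_(v ord0 i *: delta_mx ord0 i) f = fun y => v ord0 i *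
        partial i f y).
      by move=> y; apply: continuousM; [exact: cst_continuous|exact: cf].
    exact/funext.
  have dD y : derivable f y (v ord0 i *: delta_mx ord0 i) by have [] := H y.
  exact: (is_derive_add dD cD dih).
move=> /(_ (index_enum _)); congr (is_derive _ _ _ _).
by rewrite {2}[v]row_sum_delta.
Qed.

Lemma is_derive_affine f A b x i :
  (forall j y, derivable f y (delta_mx ord0 j)) ->
  (forall j, continuous (partial j f)) ->
  is_derive x (delta_mx ord0 i) (fun x => f (x *m A + b))
     (\sum_j A i j * partial j f (x *m A + b)).
Proof.
move=> df cf; have [dl el] := is_derive_partials (row i A) (x *m A + b) df cf.
have E : (fun h : R => h^-1 *: (((fun x => f (x *m A + b)) \o shift x) (h *:
    delta_mx ord0 i) - f (x *m A + b))) =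
    (fun h : R => h^-1 *: ((f \o shift (x *m A + b)) (h *: row i A) - f (x *m
        A + b))).
  by apply/funext => h /=; rewrite mulmxDl -scalemxAl -rowE addrA.
split; first by rewrite /derivable E.
rewrite /derive E; apply: etrans el _.
by apply: eq_bigr => j _; rewrite mxE.
Qed.

Lemma continuous_affine A b : continuous (fun x => x *m A + b).
Proof.
move=> x B /nbhs_rVP[e e0 eB].
have H i : \forall y \near x, `|(x *m A + b) ord0 i - (y *m A + b) ord0 i| < e.
  have : continuous (fun y : 'rV[R]_n => (y *m A + b) ord0 i).
    have -> : (fun y : 'rV[R]_n => (y *m A + b) ord0 i) =
       (fun y => \sum_j y ord0 j * A j i + b ord0 i) by apply/funext => y;
           rewrite !mxE.
    have cs (s : seq 'I_n) : continuous (fun y : 'rV[R]_n => \sum_(j <- s) y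
        ord0 j * A j i).
      elim: s => [|j s ih] y.
        by under eq_fun do rewrite big_nil; exact: cst_continuous.
      under eq_fun do rewrite big_cons.
      apply: (@continuousD _ _ _ (fun y : 'rV[R]_n => y ord0 j * A j i)); last
          exact: ih.
      apply: (@continuousM _ _ (fun y : 'rV[R]_n => y ord0 j) (fun=> A j i)).
        exact: coord_continuous.
      exact: cst_continuous.
    by move=> y; apply: continuousD; [exact: cs|exact: cst_continuous].
  by move=> /(_ x) /cvgrPdist_lt/(_ e e0).
have /(_ (nbhs_filter x)) HH := filter_forall _ H.
by apply: filterS HH => y Hy; exact: eB.
Qed.

Lemma smooth_affine phi A b : smooth phi -> smooth (fun x => phi (x *m A + b)).
Proof.
move=> sphi s.
(* Linear combinations of iterated partials of [phi] at the transformed point, coded as lists of a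
   coefficient and a multi-index. By the chain rule this class is stable under [partial], which the
   composition with [phi] alone is not. *)
pose F (l : seq (R * seq 'I_n)) := fun x => \sum_(k <- l) k.1 * foldr partial
    phi k.2 (x *m A + b).
have FD l i x : is_derive x (delta_mx ord0 i) (F l)
    (\sum_(k <- l) \sum_j k.1 * A i j * foldr partial phi (j :: k.2) (x *m A +
        b)).
  rewrite /F; elim: l => [|k l ih].
    by under eq_fun do rewrite big_nil; rewrite big_nil; exact: is_derive_cst.
  under eq_fun do rewrite big_cons; rewrite big_cons.
  have H : is_derive x (delta_mx ord0 i) (fun x => k.1 * foldr partial phi k.2
      (x *m A + b))
      (\sum_j k.1 * A i j * foldr partial phi (j :: k.2) (x *m A + b)).
    have H0 : is_derive x (delta_mx ord0 i) (fun x => foldr partial phi k.2 (x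
        *m A + b))
      (\sum_j A i j * partial j (foldr partial phi k.2) (x *m A + b)).
      apply: is_derive_affine; first by move=> j y; have [_] := sphi k.2; apply.
      by move=> j; have [] := sphi (j :: k.2).
    have := is_deriveZ k.1 H0; congr (is_derive _ _ _ _).
    by rewrite scaler_sumr; apply: eq_bigr => j _; rewrite /GRing.scale/= mulrA.
  exact: (is_deriveD H ih).
have Fc l : continuous (F l).
  rewrite /F; elim: l => [|k l ih] x.
    by under eq_fun do rewrite big_nil; exact: cst_continuous.
  under eq_fun do rewrite big_cons.
  apply: (@continuousD _ _ _ (fun x => k.1 * foldr partial phi k.2 (x *m A +
      b))); last exact: ih.
  apply: (@continuousM _ _ (fun=> k.1)); first exact: cst_continuous.
  apply: (@continuous_comp _ _ _ (fun x => x *m A + b) (foldr partial phi k.2)).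
    exact: continuous_affine.
  by have [c _] := sphi k.2; exact: c.
have [l ->] : exists l, foldr partial (fun x => phi (x *m A + b)) s = F l.
  elim: s => [|i s [l E]].
    by exists [:: (1, [::])]; apply/funext => x; rewrite /F big_seq1 mul1r.
  exists [seq (k.1 * A i j, j :: k.2) | k <- l, j <- index_enum 'I_n].
  apply/funext => x; rewrite /= E /partial; have [_ ->] := FD l i x.
  by rewrite /F big_allpairs_dep.
by split => // i x; have [] := FD l i x.
Qed.

Lemma test_function_affine phi A A' b : A *m A' = 1%:M -> test_function phi ->
  test_function (fun x => phi (x *m A + b)).
Proof.
move=> AA tphi; split; first by apply: smooth_affine; case: tphi.
have [M HM] := test_function_cube tphi.
pose M' := \sum_j \sum_i (M + `|b ord0 j|) * `|A' j i|.
apply: (@supp_compact _ _ _ M') => x /HM xM i.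
have -> : x ord0 i = \sum_j ((x *m A + b) ord0 j - b ord0 j) * A' j i.
  have {1}-> : x = (x *m A + b - b) *m A' by rewrite addrK -mulmxA AA mulmx1.
  by rewrite [LHS]mxE; apply: eq_bigr => j _; rewrite !mxE.
rewrite /= in_itv/= -ler_norml (le_trans (ler_norm_sum _ _ _))//.
apply: ler_sum => j _.
have := xM j; rewrite /= in_itv/= -ler_norml => xj.
apply: (@le_trans _ _ ((M + `|b ord0 j|) * `|A' j i|)).
  by rewrite normrM ler_wpM2r// (le_trans (ler_normB _ _))// lerD2r.
rewrite (bigD1 i)//= lerDl sumr_ge0// => k _.
by rewrite mulr_ge0// addr_ge0// (le_trans _ xj).
Qed.

Lemma test_function_shift phi b : test_function phi ->
  test_function (fun x => phi (x + b)).
Proof.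
move=> /(test_function_affine b (mulmx1 (1%:M : 'M[R]_n))).
by under eq_fun do rewrite mulmx1.
Qed.

End chain_rule.

(** * Differentiation of integrals against translated test functions *)

Section derivative_under_integral.
Context {R : realType} {n : nat}.
Implicit Types (x v b : 'rV[R]_n) (u phi : 'rV[R]_n -> R) (i : 'I_n).
Local Notation mu := (@lebesgue_rV R n).

Lemma is_derive_shift phi i x (t : R) : test_function phi ->
  is_derive t 1 (fun s : R => phi (x + s *: delta_mx ord0 i))
    (partial i phi (x + t *: delta_mx ord0 i)).
Proof.
move=> tphi; under eq_fun do rewrite addrC; rewrite [x + _]addrC.
by apply/is_derive_line; apply: derivableP; exact: test_function_derivable.
Qed.

Lemma partial_shift phi i b x :
  partial i (fun x => phi (x + b)) x = partial i phi (x + b).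
Proof.
rewrite /partial /derive.
suff -> : (fun h : R => h^-1 *: (((fun x => phi (x + b)) \o shift x) (h *:
    delta_mx ord0 i) - phi (x + b))) =
  (fun h : R => h^-1 *: ((phi \o shift (x + b)) (h *: delta_mx ord0 i) - phi
      (x + b))) by [].
by apply/funext => h /=; rewrite addrA.
Qed.

(** A continuous function that is nonzero at a point is nonzero on a box around it, and a box with
    nonempty sides is not negligible. *)
Lemma continuous_ae_eq0 u : continuous u -> {ae mu, forall x, u x = 0} ->
  forall x, u x = 0.
Proof.
move=> cu [B [mB B0 sB]] x; apply: contrapT => /eqP ux.
have /nbhs_rVP[e e0 He] : \forall y \near x, u y != 0.
  have : nbhs (u x) [set r | r != 0].
    by apply: open_nbhs_nbhs; split => //; exact: open_neq.
  exact: cu.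
have sub : obox (fun i => x ord0 i - e) (fun i => x ord0 i + e) `<=` B.
  move=> y xy; apply: sB => /=; apply/eqP; apply: He => i.
  by rewrite distrC ltr_distl; exact: xy.
have : (mu (obox (fun i => x ord0 i - e)%R (fun i => x ord0 i + e)%R) <= mu
    B)%E.
  by apply: le_measure => //; rewrite inE//; exact: measurable_obox.
rewrite B0 lebesgue_obox lee_fin leNgt => /negP; apply.
by apply: prodr_gt0 => i _; rewrite lt_max; apply/orP; left; lra.
Qed.

Lemma is_derive_integral_shift u phi i (a : R) : L1loc u -> test_function phi ->
  is_derive a 1 (fun t : R => \int[mu]_x (u x * phi (x + t *: delta_mx ord0 i)))
    (\int[mu]_x (u x * partial i phi (x + a *: delta_mx ord0 i))).
Proof.
move=> Lu tphi.
have tp := test_function_partial i tphi.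
have [M HM] := test_function_cube tp.
have [C C0 HC] := continuous_supp_bounded (test_function_continuous tp) HM.
pose f (t : R) x := u x * phi (x + t *: delta_mx ord0 i).
have fd (t : R) x : is_derive t 1 (f ^~ x) (u x * partial i phi (x + t *:
    delta_mx ord0 i)).
  by apply: is_deriveZl; exact: is_derive_shift.
have pE t x : partial1of2 f t x = u x * partial i phi (x + t *: delta_mx ord0
    i).
  by rewrite partial1of2E; have [_ ->] := fd t x.
(* For [t] within 1 of [a] a translate by [t] along an axis moves the support by at most [|a| + 1],
   so a single cube contains all of the supports and carries the dominating function [G]. *)
pose M' := M + (`|a| + 1).
pose G x := C * `|u x| * \1_(cube M') x.
have Ia : `]a - 1, a + 1[%classic a by rewrite /= in_itv/= ltrDl ltrBlDr ltrDl
    ltr01.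
have intf (t : R) : `]a - 1, a + 1[%classic t -> mu.-integrable setT (EFin \o
    f t).
  by move=> _; apply: test_mul_integrable => //; exact: test_function_shift.
have df (t : R) x : `]a - 1, a + 1[%classic t -> [set: 'rV[R]_n] x ->
    derivable (f ^~ x) t 1.
  by move=> _ _; have [] := fd t x.
have G0 x : 0 <= G x by rewrite /G !mulr_ge0// ltW.
have iG : mu.-integrable setT (EFin \o G).
  have /(integrable_mkcond _ (@measurable_cube R n M')) := L1loc_integrable Lu
      (@compact_cube R n M').
  move=> /(@integrableZl _ _ _ _ _ measurableT C).
  apply: le_integrable => //.
    apply/measurable_EFinP; apply: measurable_funM; last exact:
        measurable_indic (measurable_cube _).
    apply: measurable_funM => //; apply: measurableT_comp => //; by case: Lu.
  move=> x _ /=; rewrite patchE /G indicE; case: ifPn => xM.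
    by rewrite mulr1 /= lee_fin !normrM normr_id.
  by rewrite mulr0 /= normr0 lee_fin.
have Gub (t : R) x : `]a - 1, a + 1[%classic t -> [set: 'rV[R]_n] x ->
    `|partial1of2 f t x| <= G x.
  rewrite /= in_itv/= => /andP[t1 t2] _; rewrite pE /G indicE.
  have [xM|xM] := boolP (x \in cube M').
    by rewrite mulr1 normrM mulrC ler_wpM2r.
  rewrite mulr0 normr_le0; apply/eqP.
  have [->|/HM px] := eqVneq (partial i phi (x + t *: delta_mx ord0 i)) 0.
    by rewrite mulr0.
  exfalso; move: xM; rewrite notin_setE; apply => j.
  have := px j; rewrite /= !in_itv/= -!ler_norml !mxE => Hj.
  have -> : x ord0 j = x ord0 j + t * (delta_mx ord0 i : 'rV[R]_n) ord0 j - t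
      * (delta_mx ord0 i : 'rV[R]_n) ord0 j by rewrite addrK.
  rewrite (le_trans (ler_normB _ _))// lerD//; first by rewrite mxE.
  rewrite normrM mxE; apply: (@le_trans _ _ `|t|).
    by rewrite ler_piMr//; case: (_ && _); rewrite ?normr1 ?normr0.
  rewrite -lerBlDl (le_trans (lerB_dist _ _))//.
  by rewrite ler_norml; apply/andP; split; lra.
have dF := @derivable_under_integral R _ _ mu f setT measurableT a _ _ Ia intf
    df G G0 iG Gub.
have eF := @differentiation_under_integral R _ _ mu f setT measurableT a _ _
    Ia intf df G G0 iG Gub.
split; first exact: dF.
rewrite -derive1E eF; apply: eq_Rintegral => x _; exact: pE.
Qed.

Lemma test_function_integrable phi : test_function phi ->
  mu.-integrable setT (EFin \o phi).
Proof.
move=> tphi; have := test_mul_integrable (continuous_L1loc (@cst_continuous _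
    _ (1:R))) tphi.
by under eq_fun do rewrite mul1r.
Qed.

(** By translation invariance the integral of [phi] shifted by [t] along the axis does not depend on
    [t]; its derivative at 0 is the integral of the partial derivative. *)
Lemma integral_partial phi i : test_function phi -> (\int[mu]_x (partial i phi
    x)%:E = 0)%E.
Proof.
move=> tphi; have tp := test_function_partial i tphi.
have [_] := is_derive_integral_shift i 0 (continuous_L1loc (@cst_continuous _
    _ (1:R))) tphi.
rewrite (_ : (fun t : R => _) = cst (\int[mu]_x phi x)); last first.
  apply/funext => t /=; congr fine.
  under eq_integral do rewrite mul1r.
  have := scales_integral (f := EFin \o phi) (scales_translation (t *:
      delta_mx ord0 i)).
  rewrite mul1e => -> //; apply/measurable_EFinP; apply:
      continuous_measurable_rV.
  exact: test_function_continuous.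
rewrite derive_cst => /esym; under eq_Rintegral do rewrite scale0r addr0 mul1r.
rewrite /Rintegral => E; rewrite -[LHS]fineK ?E//.
by apply: integrable_fin_num => //; exact: test_function_integrable.
Qed.

(* Each difference [u (x + b) - u x] is orthogonal to every test function. *)
Lemma weak_gradient_eq0_cst u : continuous u ->
  (forall i phi, test_function phi -> \int[mu]_x (u x * partial i phi x)%:E =
      0)%E ->
  forall x y, u x = u y.
Proof.
move=> cu H; have Lu := continuous_L1loc cu.
have mu_ := continuous_measurable_rV cu.
have inv i (t : R) x : u (x + t *: delta_mx ord0 i) = u x.
  pose b := t *: (delta_mx ord0 i : 'rV[R]_n).
  have cub : continuous (fun x => u (x + b)).
    move=> z; apply: (@continuous_comp _ _ _ (fun z : 'rV[R]_n => z + b) u);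
        last exact: cu.
    have := @continuous_affine R n 1%:M b z.
    by under eq_fun do rewrite mulmx1.
  have : {ae mu, forall x, u (x + b) - u x = 0}.
    apply: fundamental_lemma.
      by apply: continuous_L1loc => z; apply: continuousB; [exact: cub|exact:
          cu].
    move=> phi tphi.
    have tb : test_function (fun x => phi (x - b)) by exact:
        test_function_shift.
    have E1 : (\int[mu]_x (u (x + b) * phi x)%:E = \int[mu]_x (u x * phi (x -
        b))%:E)%E.
      have := scales_integral (f := fun x => (u x * phi (x - b))%:E)
          (scales_translation b).
      rewrite mul1e => <-.
        by apply: eq_integral => z _; rewrite addrK.
      apply/measurable_EFinP; apply: measurable_funM => //.
      by apply: continuous_measurable_rV; exact: (test_function_continuous tb).
    under eq_integral do rewrite mulrBl EFinB.
    have i1 := test_mul_integrable Lu tb.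
    have i2 := test_mul_integrable Lu tphi.
    have i3 := test_mul_integrable (continuous_L1loc cub) tphi.
    rewrite integralB// E1.
    (* The hypothesis on [u] applies to every translate of [phi], so the pairing of [u] with the
       translates has zero derivative everywhere and is constant; its values at [- t] and 0 are then
       compared. *)
    have dF (a : R) : is_derive a 1 (fun t : R => \int[mu]_x (u x * phi (x + t
        *: delta_mx ord0 i))) 0.
      apply: (is_derive_eq (is_derive_integral_shift i a Lu tphi)).
      rewrite /Rintegral.
      suff -> : (\int[mu]_z (u z * partial i phi (z + a *: delta_mx ord0
          i))%:E = 0)%E by [].
      rewrite -[RHS](H i _ (test_function_shift (a *: delta_mx ord0 i) tphi)).
      by apply: eq_integral => z _; rewrite partial_shift.
    have := is_derive_0_is_cst (- t) 0 dF.
    rewrite scaleNr scale0r /Rintegral => E.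
    have E2 : (\int[mu]_x (u x * phi (x - b))%:E = \int[mu]_x (u x * phi
        x)%:E)%E.
      rewrite -[LHS]fineK; last exact: integrable_fin_num.
      rewrite -[RHS]fineK; last exact: integrable_fin_num.
      congr (_%:E); rewrite /b E; congr fine.
      by apply: eq_integral => z _; rewrite addr0.
    by rewrite E2 subee//; exact: integrable_fin_num.
  move=> /(continuous_ae_eq0 _)/(_ x)/eqP; rewrite subr_eq0 => H0; apply/eqP/H0.
  by move=> z; apply: continuousB; [exact: cub|exact: cu].
move=> x y; have -> : y = x + \sum_i (y - x) ord0 i *: delta_mx ord0 i.
  by rewrite -row_sum_delta addrC subrK.
elim: (index_enum _) => [|i s ->]; first by rewrite big_nil addr0.
by rewrite big_cons addrA addrAC inv.
Qed.

End derivative_under_integral.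

(** * Weak gradients *)

Section Lfun_facts.
Context {R : realType} {n : nat}.
Local Notation mu := (@lebesgue_rV R n).
Implicit Types (u v f g : 'rV[R]_n -> R).

Lemma Lfun_powR_integrableP (p : R) f : 1 <= p -> (f \in Lfun mu p%:E) <->
  measurable_fun setT f /\ mu.-integrable setT (fun x => (`|f x| `^ p)%:E).
Proof.
move=> p1; split=> [Lf|[mf fi]].
  split; last exact: Lfun_integrable.
  by have := sub_Lfun_mfun Lf; rewrite inE.
rewrite inE; apply/andP; split; rewrite inE//=.
rewrite /finite_norm unlock; apply: poweR_lty.
have /integrableP[_] := fi; apply: le_lt_trans.
by under [leRHS]eq_integral do rewrite gee0_abs ?lee_fin ?powR_ge0//.
Qed.

Lemma L1loc_lin (c : R) u v : L1loc u -> L1loc v -> L1loc (fun x => c * u x +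
    v x).
Proof.
move=> Lu Lv; have [mu_ _] := Lu; have [mv _] := Lv.
have mw : measurable_fun setT (fun x => c * u x + v x).
  by apply: measurable_funD => //; exact: measurable_funM.
split => // K cK.
have mK := compact_measurable_rV cK.
have := integrableD mK (integrableZl mK c (L1loc_integrable Lu cK))
    (L1loc_integrable Lv cK).
by move=> /integrableP[_].
Qed.

Lemma integral_lin (c : R) f g : mu.-integrable setT (EFin \o f) ->
  mu.-integrable setT (EFin \o g) ->
  (\int[mu]_x (c * f x + g x)%:E = c%:E * \int[mu]_x (f x)%:E + \int[mu]_x (g
      x)%:E)%E.
Proof.
move=> fi gi; under eq_integral do rewrite EFinD EFinM.
rewrite integralD//; last exact: integrableZl.
by rewrite integralZl.
Qed.

Lemma integrable_lin (c : R) f g : mu.-integrable setT (EFin \o f) ->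
  mu.-integrable setT (EFin \o g) ->
  mu.-integrable setT (fun x => (c * f x + g x)%:E).
Proof.
move=> fi gi; have := integrableD measurableT (integrableZl measurableT c fi)
    gi.
exact: eq_integrable.
Qed.

Lemma le_integral_EFin f g : mu.-integrable setT (EFin \o f) ->
  mu.-integrable setT (EFin \o g) -> (forall x, f x <= g x) ->
  (\int[mu]_x (f x)%:E <= \int[mu]_x (g x)%:E)%E.
Proof. by move=> fi gi fg; apply: le_integral => // x _; rewrite lee_fin. Qed.

Lemma integral_fin f : mu.-integrable setT (EFin \o f) ->
  exists r : R, (\int[mu]_x (f x)%:E = r%:E)%E.
Proof.
move=> fi; exists (fine (\int[mu]_x (f x)%:E)%E); rewrite fineK//.
exact: integrable_fin_num.
Qed.

Lemma weak_partial_unique u i g g' : weak_partial u i g -> weak_partial u i g'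
    ->
  {ae mu, forall x, g x = g' x}.
Proof.
move=> [Lg Hg] [Lg' Hg'].
have : {ae mu, forall x, -1 * g' x + g x = 0}.
  apply: fundamental_lemma; first exact: L1loc_lin.
  move=> phi tphi.
  under eq_integral do rewrite mulrDl -mulrA.
  have i1 := test_mul_integrable Lg tphi; have i2 := test_mul_integrable Lg'
      tphi.
  rewrite integral_lin//.
  have := Hg _ tphi; rewrite (Hg' _ tphi).
  have [r ->] := integral_fin i1; have [r' ->] := integral_fin i2.
  by rewrite -!EFinN -EFinM -EFinD => -[E]; congr EFin; lra.
by apply: filterS => x E; lra.
Qed.

Lemma weak_partial_lin (c : R) u v i g h : L1loc u -> L1loc v ->
  weak_partial u i g -> weak_partial v i h ->
  weak_partial (fun x => c * u x + v x) i (fun x => c * g x + h x).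
Proof.
move=> Lu Lv [Lg Hg] [Lh Hh]; split; first exact: L1loc_lin.
move=> phi tphi; have tp := test_function_partial i tphi.
under eq_integral do rewrite mulrDl -mulrA.
under [in RHS]eq_integral do rewrite mulrDl -mulrA.
have i1 := test_mul_integrable Lg tphi; have i2 := test_mul_integrable Lh tphi.
have i3 := test_mul_integrable Lu tp; have i4 := test_mul_integrable Lv tp.
rewrite !integral_lin// Hg// Hh//.
have [r ->] := integral_fin i1; have [r' ->] := integral_fin i2.
by rewrite -!EFinN -!EFinM -!EFinD; congr EFin; lra.
Qed.

Lemma weak_partial_cst (c : R) i : weak_partial (cst c : 'rV[R]_n -> R) i (cst
    0).
Proof.
split; first by apply: continuous_L1loc => x; exact: cst_continuous.
move=> phi tphi; under eq_integral do rewrite EFinM.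
rewrite integralZl//; last exact: (test_function_integrable
    (test_function_partial i tphi)).
rewrite integral_partial// mule0.
by under eq_integral do rewrite /= mul0r; rewrite integral0 oppe0.
Qed.

End Lfun_facts.

(** * Weak derivatives under similarities *)

Section affine.
Context {R : realType} {n : nat}.
Local Notation mu := (@lebesgue_rV R n).
Implicit Types (u v f g : 'rV[R]_n -> R).
Variables (A : 'M[R]_n) (b : 'rV[R]_n) (s : R).
Hypotheses (s0 : 0 < s) (AA : A *m A^T = (s ^+ 2)%:M).
Let T x := x *m A + b.

Lemma L1loc_affine g : L1loc g -> L1loc (fun x => g (T x)).
Proof.
move=> Lg; have [mg Hg] := Lg; have sT := scales_similarity b s0 AA.
have [mT c0 _] := sT.
split; first exact: (measurableT_comp mg mT).
move=> K cK; have mK := compact_measurable_rV cK.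
have cTK : compact (T @` K).
  apply: continuous_compact => //; apply: continuous_subspaceT; exact:
      continuous_affine.
have mTK := compact_measurable_rV cTK.
rewrite integral_mkcond.
pose h := (fun x => `|(g x)%:E|%E) \_ (T @` K).
have mh : measurable_fun setT h.
  apply/(measurable_restrictT _ mTK); apply: measurable_funTS.
  by apply: measurableT_comp => //; exact/measurable_EFinP.
have h0 x : (0 <= h x)%E by rewrite /h patchE; case: ifP => // _; exact:
    abse_ge0.
apply: (@le_lt_trans _ _ (\int[mu]_x h (T x))%E).
  apply: ge0_le_integral => //.
  - by move=> x _; rewrite patchE; case: ifP => // _; exact: abse_ge0.
  - apply/(measurable_restrictT _ mK); apply: measurable_funTS.
    by apply: measurableT_comp => //; apply/measurable_EFinP; exact:
        (measurableT_comp mg mT).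
  - exact: (measurableT_comp mh mT).
  - move=> x _; rewrite patchE; case: ifPn => [xK|_]; last exact: h0.
    rewrite /h patchE mem_set//; exists x => //; exact: set_mem.
rewrite (scales_ge0_integral sT mh h0) /h -integral_mkcond.
have := Hg _ cTK.
have : (0 <= \int[mu]_(x in T @` K) `|(g x)%:E|)%E by apply: integral_ge0 => x
    _; exact: abse_ge0.
by case: (\int[mu]_(x in T @` K) `|(g x)%:E|)%E => // r _ _; rewrite -EFinM
    ltry.
Qed.

(** The chain rule is applied to the test function, not to [u]: writing [phi] as [psi] after [T],
    with [A' = s ^- 2 *: A^T] the inverse matrix, turns a partial of [phi] into a combination of
    partials of [psi]. The changes of variables on the two sides produce the same factor
    [s ^- n]. *)
Lemma weak_partial_affine u (g : 'I_n -> 'rV[R]_n -> R) i : L1loc u ->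
  (forall j, weak_partial u j (g j)) ->
  weak_partial (fun x => u (T x)) i (fun x => \sum_j A i j * g j (T x)).
Proof.
move=> Lu Hg; have sT := scales_similarity b s0 AA; have [mT c0 _] := sT.
have Lsum : L1loc (fun x => \sum_j A i j * g j x).
  elim: (index_enum _) => [|j l ih].
    by under eq_fun do rewrite big_nil; apply: continuous_L1loc => x; exact:
        cst_continuous.
  under eq_fun do rewrite big_cons.
  by apply: L1loc_lin => //; case: (Hg j).
split; first exact: (L1loc_affine Lsum).
move=> phi tphi.
pose A' := s ^- 2 *: A^T.
have AA' : A *m A' = 1%:M.
  rewrite -scalemxAr AA scale_scalar_mx mulVf// expf_neq0// gt_eqF//.
have A'A := mulmx1C AA'.
pose psi x := phi (x *m A' + - (b *m A')).
have tpsi : test_function psi := test_function_affine (- (b *m A')) A'A tphi.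
have phiE x : phi x = psi (T x).
  by rewrite /psi /T mulmxDl -mulmxA AA' mulmx1 addrK.
have pphiE x : partial i phi x = \sum_j A i j * partial j psi (T x).
  have -> : phi = fun x => psi (T x) by exact/funext.
  have [_ E] := @is_derive_affine R n psi A b x i
    (fun j y => test_function_derivable tpsi)
    (fun j => test_function_continuous (test_function_partial j tpsi)).
  exact: E.
have iu j := test_mul_integrable Lu (test_function_partial j tpsi).
have ig j : mu.-integrable setT (fun x => (g j x * psi x)%:E).
  by apply: test_mul_integrable => //; case: (Hg j).
have sumI (f : 'I_n -> 'rV[R]_n -> R) : (forall j, mu.-integrable setT (EFin
    \o f j)) ->
    (\int[mu]_x (\sum_j A i j * f j x)%:E = \sum_j (A i j)%:E * \int[mu]_x (f
        j x)%:E)%E.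
  move=> If; transitivity (\int[mu]_x (\sum_j ((A i j)%:E * (f j x)%:E)))%E.
    by apply: eq_integral => x _; rewrite -sumEFin.
  rewrite integral_sum//; last by move=> j; exact: (integrableZl measurableT
      (A i j) (If j)).
  by apply: eq_bigr => j _; rewrite (integralZl measurableT (If j)).
transitivity ((s ^- n)%:E * \sum_j (A i j)%:E * \int[mu]_x (u x * partial j
    psi x)%:E)%E.
  rewrite -sumI//.
  rewrite -(scales_integral (f := fun x => (\sum_j A i j * (u x * partial j
      psi x))%:E) sT).
    apply: eq_integral => x _; rewrite pphiE mulr_sumr; congr (_%:E).
    by apply: eq_bigr => j _; rewrite mulrCA.
  apply/measurable_EFinP; apply: measurable_sum => j; apply: measurable_funM
      => //.
  by have /integrableP[/measurable_EFinP] := iu j.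
have -> : (\int[mu]_x ((\sum_j A i j * g j (T x)) * phi x)%:E =
  (s ^- n)%:E * \sum_j (A i j)%:E * \int[mu]_x (g j x * psi x)%:E)%E.
  rewrite -sumI//.
  rewrite -(scales_integral (f := fun x => (\sum_j A i j * (g j x * psi
      x))%:E) sT).
    apply: eq_integral => x _; rewrite mulr_suml phiE; congr (_%:E).
    by apply: eq_bigr => j _; rewrite mulrA.
  apply/measurable_EFinP; apply: measurable_sum => j; apply: measurable_funM
      => //.
  by have /integrableP[/measurable_EFinP] := ig j.
have fj j : exists r : R, (\int[mu]_x (g j x * psi x)%:E = r%:E)%E by exact:
    (integral_fin (ig j)).
have [r rE] := choice fj.
under eq_bigr do rewrite (Hg _).2// rE -EFinN -EFinM.
under [in RHS]eq_bigr do rewrite rE -EFinM.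
rewrite !sumEFin -!EFinM -EFinN; congr EFin.
rewrite -mulrN -sumrN; congr (_ * _); apply: eq_bigr => j _; by rewrite mulrN.
Qed.

Lemma Lfun_affine (p : R) g : 1 <= p -> g \in Lfun mu p%:E -> (fun x => g (T
    x)) \in Lfun mu p%:E.
Proof.
move=> p1 /(Lfun_powR_integrableP _ p1)[mg /integrableP[mgp gi]].
have sT := scales_similarity b s0 AA; have [mT c0 _] := sT.
apply/(Lfun_powR_integrableP _ p1); split; first exact: (measurableT_comp mg
    mT).
apply/integrableP; split; first exact: (measurableT_comp mgp mT).
rewrite (scales_ge0_integral (f := fun x => `|(`|g x| `^ p)%:E|%E) sT)//; last
    exact: measurableT_comp.
by rewrite lte_mul_pinfty// ?lee_fin ?(ltW c0)//.
Qed.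

End affine.

Section weak_gradient.
Context {R : realType} {n : nat}.
Local Notation mu := (@lebesgue_rV R n).
Implicit Types (u v f g : 'rV[R]_n -> R) (G H : 'rV[R]_n -> 'rV[R]_n) (p : R).

(** A relation, because weak gradients are classes modulo null sets: sums and compositions get
    explicit fields [G] that agree only almost everywhere with the representative chosen by
    [wgrad]. *)
Definition is_wgrad p u G := forall i,
  weak_partial u i (fun x => G x ord0 i) /\ (fun x => G x ord0 i) \in Lfun mu
      p%:E.

Lemma D1pP p u : D1p p u <-> continuous u /\ exists G, is_wgrad p u G.
Proof.
split=> [[cu _ H]|[cu [G HG]]].
  split => //.
  have /choice[g Hg] : forall i, exists g, weak_partial u i g /\ g \in Lfun mu
      p%:E.
    by move=> i; have [g wg gp] := H i; exists g.
  exists (fun x => \row_i g i x) => i.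
  by under eq_fun do rewrite mxE; exact: Hg.
split => //; first exact: continuous_L1loc.
by move=> i; have [wg gp] := HG i; exists (fun x => G x ord0 i).
Qed.

Lemma Lfun_ae_eq p f g : 1 <= p -> f \in Lfun mu p%:E -> measurable_fun setT g
    ->
  {ae mu, forall x, f x = g x} -> g \in Lfun mu p%:E.
Proof.
move=> p1 /(Lfun_powR_integrableP _ p1)[mf /integrableP[mfp fi]] mg fg.
apply/(Lfun_powR_integrableP _ p1); split => //.
have mgp : measurable_fun setT (fun x => (`|g x| `^ p)%:E).
  apply/measurable_EFinP; apply: (measurableT_comp (measurable_powR _)) => //.
  exact: measurableT_comp.
apply/integrableP; split; first exact: mgp.
apply: le_lt_trans fi; rewrite le_eqVlt; apply/orP; left; apply/eqP.
apply: ge0_ae_eq_integral => //; [exact: measurableT_comp|exact: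
    measurableT_comp|].
by apply: filterS fg => x fgx _; rewrite fgx.
Qed.

Lemma weak_partial_wgrad u i g : weak_partial u i g ->
  weak_partial u i (fun x => wgrad u x ord0 i).
Proof.
move=> wg; have -> : (fun x => wgrad u x ord0 i) = xget (cst 0) [set g |
    weak_partial u i g].
  by apply/funext => x; rewrite mxE.
by case: xgetP => [h _ //|/(_ g)].
Qed.

Lemma is_wgrad_wgrad p u : 1 <= p -> D1p p u -> is_wgrad p u (wgrad u).
Proof.
move=> p1 [cu _ H] i; have [g wg gp] := H i.
have wgw := weak_partial_wgrad wg; split => //.
apply: Lfun_ae_eq gp _ _ => //; first by case: wgw => -[].
exact: weak_partial_unique wg wgw.
Qed.

Lemma is_wgrad_unique p u G H : is_wgrad p u G -> is_wgrad p u H ->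
  {ae mu, forall x, G x = H x}.
Proof.
move=> HG HH.
have U i : {ae mu, forall x, G x ord0 i = H x ord0 i}.
  exact: weak_partial_unique (HG i).1 (HH i).1.
have /(_ (ae_filter_ringOfSetsType mu)) := filter_forall _ U.
by apply: filterS => x E; apply/rowP => i; exact: E.
Qed.

Lemma is_wgrad_lin p (c : R) u v G H : 1 <= p -> continuous u -> continuous v ->
  is_wgrad p u G -> is_wgrad p v H ->
  is_wgrad p (fun x => c * u x + v x) (fun x => c *: G x + H x).
Proof.
move=> p1 cu cv HG HH i; have [wG LG] := HG i; have [wH LH] := HH i.
rewrite (_ : (fun x => (c *: G x + H x) ord0 i) = fun x => c * G x ord0 i + H
    x ord0 i); last first.
  by apply/funext => x; rewrite !mxE.
split; first by apply: weak_partial_lin => //; exact: continuous_L1loc.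
have [_ H1] := @Lfun_submod_closed _ _ _ mu p%:E (ltac:(by rewrite lee_fin)).
exact: H1 c _ _ LG LH.
Qed.

Lemma is_wgrad_cst p (c : R) : 1 <= p -> is_wgrad p (cst c) (cst 0).
Proof.
move=> p1 i; under eq_fun do rewrite mxE.
split; first exact: weak_partial_cst.
by have [] := @Lfun_submod_closed _ _ _ mu p%:E (ltac:(by rewrite lee_fin)).
Qed.

Lemma is_wgrad_affine p (A : 'M[R]_n) (b : 'rV[R]_n) (s : R) u G : 1 <= p ->
  0 < s -> A *m A^T = (s ^+ 2)%:M -> continuous u -> is_wgrad p u G ->
  is_wgrad p (fun x => u (x *m A + b)) (fun x => G (x *m A + b) *m A^T).
Proof.
move=> p1 s0 AA cu HG i.
have -> : (fun x => (G (x *m A + b) *m A^T) ord0 i) =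
   (fun x => \sum_j A i j * G (x *m A + b) ord0 j).
  by apply/funext => x; rewrite mxE; apply: eq_bigr => j _; rewrite mxE mulrC.
split.
  apply: (weak_partial_affine b s0 AA (g := fun j x => G x ord0 j)).
    exact: continuous_L1loc.
  by move=> j; case: (HG j).
have [H0 H1] := @Lfun_submod_closed _ _ _ mu p%:E (ltac:(by rewrite lee_fin)).
elim: (index_enum _) => [|j l ih].
  by under eq_fun do rewrite big_nil; exact: H0.
under eq_fun do rewrite big_cons.
apply: (H1 (A i j) _ _ _ ih).
apply: (Lfun_affine b s0 AA (g := fun x => G x ord0 j)) => //; by case: (HG j).
Qed.

Lemma D1p_lin p (c : R) u v : 1 <= p -> D1p p u -> D1p p v ->
  D1p p (fun x => c * u x + v x).
Proof.
move=> p1 /D1pP[cu [G HG]] /D1pP[cv [H HH]]; apply/D1pP; split.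
  move=> x; apply: (@continuousD _ _ _ (fun x => c * u x)); last exact: cv.
  by apply: (@continuousM _ _ (cst c)); [exact: cst_continuous|exact: cu].
by exists (fun x => c *: G x + H x); exact: is_wgrad_lin.
Qed.

Lemma D1p_cst p (c : R) : 1 <= p -> D1p p (cst c : 'rV[R]_n -> R).
Proof.
move=> p1; apply/D1pP; split; first by move=> x; exact: cst_continuous.
by exists (cst 0); exact: is_wgrad_cst.
Qed.

Lemma D1p_affine p (A : 'M[R]_n) (b : 'rV[R]_n) (s : R) u : 1 <= p ->
  0 < s -> A *m A^T = (s ^+ 2)%:M -> D1p p u -> D1p p (fun x => u (x *m A + b)).
Proof.
move=> p1 s0 AA /D1pP[cu [G HG]]; apply/D1pP; split.
  move=> x; apply: (@continuous_comp _ _ _ (fun x : 'rV[R]_n => x *m A + b)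
      u); last exact: cu.
  exact: continuous_affine.
by exists (fun x => G (x *m A + b) *m A^T); exact: is_wgrad_affine s0 AA cu HG.
Qed.

Lemma is_wgrad_measurable p u G : is_wgrad p u G -> measurable_fun setT G.
Proof.
move=> HG; apply/measurable_fun_rVP => i.
by have [[[]]] := HG i.
Qed.

End weak_gradient.

(** * Convexity of the p-th power of the Euclidean norm *)

Section vectors.
Context {R : realType} {n : nat}.
Implicit Types (x y z w : 'rV[R]_n) (p : R).

Lemma enorm_ge0 x : 0 <= enorm x.
Proof. exact: sqrtr_ge0. Qed.

Lemma enorm_sqr x : enorm x ^+ 2 = edot x x.
Proof.
rewrite /enorm sqr_sqrtr; first by apply: eq_bigr => i _; rewrite expr2.
by apply: sumr_ge0 => i _; exact: sqr_ge0.
Qed.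

Lemma enorm_eq0 x : (enorm x == 0) = (x == 0).
Proof.
apply/eqP/eqP => [E|->]; last first.
  by rewrite /enorm big1 ?sqrtr0// => i _; rewrite mxE expr0n.
apply/rowP => i; rewrite mxE; apply/eqP; rewrite -normr_le0 -E.
exact: enorm_coord.
Qed.

Lemma enormZ (c : R) x : enorm (c *: x) = `|c| * enorm x.
Proof.
rewrite /enorm -sqrtr_sqr -sqrtrM ?sqr_ge0//; congr Num.sqrt.
by rewrite mulr_sumr; apply: eq_bigr => i _; rewrite mxE exprMn.
Qed.

Lemma enormN x : enorm (- x) = enorm x.
Proof. by rewrite -scaleN1r enormZ normrN1 mul1r. Qed.

Lemma edotDr x y z : edot x (y + z) = edot x y + edot x z.
Proof. by rewrite /edot -big_split/=; apply: eq_bigr => i _; rewrite mxE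
    mulrDr. Qed.

Lemma edotZr (c : R) x y : edot x (c *: y) = c * edot x y.
Proof. by rewrite /edot mulr_sumr; apply: eq_bigr => i _; rewrite mxE mulrCA.
    Qed.

Lemma edotC x y : edot x y = edot y x.
Proof. by apply: eq_bigr => i _; rewrite mulrC. Qed.

Lemma edotZl (c : R) x y : edot (c *: x) y = c * edot x y.
Proof. by rewrite edotC edotZr edotC. Qed.

Lemma edotDl x y z : edot (x + y) z = edot x z + edot y z.
Proof. by rewrite edotC edotDr !(edotC z). Qed.

Lemma edotBr x y z : edot x (y - z) = edot x y - edot x z.
Proof. by rewrite edotDr -scaleN1r edotZr mulN1r. Qed.

Lemma edot0l x : edot 0 x = 0.
Proof. by rewrite /edot big1// => i _; rewrite mxE mul0r. Qed.

Lemma edot_ge0 x : 0 <= edot x x.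
Proof. by rewrite -enorm_sqr sqr_ge0. Qed.

(** For nonzero vectors, expand the square of the norm of the difference of the two normalized
    vectors, which is nonnegative. *)
Lemma cauchy_schwarz x y : edot x y <= enorm x * enorm y.
Proof.
have [->|x0] := eqVneq x 0; first by rewrite edot0l mulr_ge0// enorm_ge0.
have [->|y0] := eqVneq y 0; first by rewrite edotC edot0l mulr_ge0// enorm_ge0.
have ex : 0 < enorm x by rewrite lt_def enorm_eq0 x0 enorm_ge0.
have ey : 0 < enorm y by rewrite lt_def enorm_eq0 y0 enorm_ge0.
have := edot_ge0 ((enorm x)^-1 *: x - (enorm y)^-1 *: y).
rewrite edotBr edotC edotBr [X in _ - X]edotC edotBr !edotZl !edotZr
    -!enorm_sqr.
rewrite (edotC y x) => H.
have : 0 <= 2 - 2 * (edot x y / (enorm x * enorm y)).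
  suff <- : (enorm x)^-1 * ((enorm x)^-1 * enorm x ^+ 2) - (enorm x)^-1 *
      ((enorm y)^-1 * edot x y) -
     ((enorm y)^-1 * ((enorm x)^-1 * edot x y) - (enorm y)^-1 * ((enorm y)^-1
         * enorm y ^+ 2)) = 2 - 2 * (edot x y / (enorm x * enorm y)).
    by [].
  by field; rewrite !gt_eqF.
set q := edot x y / _ => H1; have : q <= 1 by lra.
by rewrite /q ler_pdivrMr ?mulr_gt0// mul1r.
Qed.

Lemma normr_edot_le x y : `|edot x y| <= enorm x * enorm y.
Proof.
rewrite ler_norml cauchy_schwarz andbT lerNl.
by rewrite -[edot x y]mul1r -mulNr -edotZl (le_trans (cauchy_schwarz _ _))//
    scaleN1r enormN.
Qed.

Lemma enormD x y : enorm (x + y) <= enorm x + enorm y.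
Proof.
rewrite -(@ler_pXn2r _ 2)// ?nnegrE ?addr_ge0 ?enorm_ge0//.
rewrite enorm_sqr edotDr !edotDl -!enorm_sqr (edotC y x) sqrrD.
have := cauchy_schwarz x y; lra.
Qed.

Lemma enorm_le_sum x : enorm x <= \sum_i `|x ord0 i|.
Proof.
rewrite -(@ler_pXn2r _ 2)// ?nnegrE ?enorm_ge0 ?sumr_ge0//.
rewrite enorm_sqr expr2 mulr_sumr; apply: ler_sum => i _.
rewrite -expr2 -real_normK ?num_real// expr2 ler_wpM2r//.
by rewrite (bigD1 i)//= lerDl sumr_ge0.
Qed.

(** The norm is at most [n] times the largest coordinate, and the power of that coordinate is one
    term of the sum. The zero vector is treated apart since the maximum has to range over at least
    one index. *)
Lemma enorm_powR_le_sum p x : 0 < p ->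
  enorm x `^ p <= n%:R `^ p * \sum_i `|x ord0 i| `^ p.
Proof.
move=> p0; have [x0|] := eqVneq x 0.
  rewrite x0 (_ : enorm 0 = 0); last by apply/eqP; rewrite enorm_eq0.
  rewrite powR0 ?gt_eqF// mulr_ge0 ?powR_ge0//.
  by apply: sumr_ge0 => i _; exact: powR_ge0.
move=> /eqP/rowP x0.
have [i0 _] : exists i : 'I_n, true.
  apply: contrapT => H; apply: x0 => i; exfalso; apply: H; by exists i.
pose i := [arg max_(i > i0) `|x ord0 i|]%O.
have Hi j : `|x ord0 j| <= `|x ord0 i|.
  by rewrite /i; case: arg_maxP => // k _; apply.
apply: (@le_trans _ _ ((n%:R * `|x ord0 i|) `^ p)).
  rewrite ge0_ler_powR ?(ltW p0) ?nnegrE ?enorm_ge0 ?mulr_ge0//.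
  rewrite (le_trans (enorm_le_sum _))//.
  rewrite (le_trans (ler_sum _ (fun j _ => Hi j)))// sumr_const card_ord.
  by rewrite -[_ *+ n]mulr_natl.
rewrite powRM// ler_wpM2l ?powR_ge0//.
by rewrite (bigD1 i)//= lerDl sumr_ge0// => j _; exact: powR_ge0.
Qed.

Lemma enorm_flux p w : 1 < p -> enorm (p_flux p w) = enorm w `^ (p - 1).
Proof.
move=> p1; rewrite /p_flux enormZ ger0_norm ?powR_ge0//.
have [->|w0] := eqVneq w 0.
  have -> : enorm (0 : 'rV[R]_n) = 0 by apply/eqP; rewrite enorm_eq0.
  by rewrite mulr0 powR0//; apply/eqP; lra.
have -> : p - 1 = (p - 2) + 1 by ring.
rewrite [RHS]powRD ?enorm_eq0 ?w0 ?implybT//.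
by rewrite powRr1// enorm_ge0.
Qed.

Lemma edot_flux_self p w : 1 < p -> edot (p_flux p w) w = enorm w `^ p.
Proof.
move=> p1; rewrite /p_flux edotZl -enorm_sqr.
have [->|w0] := eqVneq w 0.
  have -> : enorm (0 : 'rV[R]_n) = 0 by apply/eqP; rewrite enorm_eq0.
  by rewrite expr0n mulr0 powR0//; apply/eqP; lra.
have -> : enorm w ^+ 2 = enorm w `^ 2 by rewrite powR_mulrn// enorm_ge0.
by rewrite -powRD ?enorm_eq0 ?w0 ?implybT// subrK.
Qed.

Lemma young_powR p (a b : R) : 1 < p -> 0 <= a -> 0 <= b ->
  p * (a `^ (p - 1) * b) <= (p - 1) * a `^ p + b `^ p.
Proof.
move=> p1 a0 b0; have p0 : 0 < p by lra.
have p10 : 0 < p - 1 by lra.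
have := @conjugate_powR R (a `^ (p - 1)) b (p / (p - 1)) p (powR_ge0 _ _) b0
    (divr_gt0 p0 p10) p0.
rewrite -powRrM (_ : (p - 1) * (p / (p - 1)) = p); last by field; rewrite
    gt_eqF.
move=> H; have {}H : a `^ (p - 1) * b <= a `^ p / (p / (p - 1)) + b `^ p / p.
  by apply: H; field; rewrite !gt_eqF.
rewrite mulrC -ler_pdivlMr//; apply: le_trans H _.
rewrite le_eqVlt; apply/orP; left; apply/eqP.
by field; rewrite !gt_eqF.
Qed.

Lemma edot_flux_le p w z : 1 < p ->
  p * `|edot (p_flux p w) z| <= (p - 1) * enorm w `^ p + enorm z `^ p.
Proof.
move=> p1; apply: (le_trans _ (young_powR p1 (enorm_ge0 w) (enorm_ge0 z))).
rewrite ler_wpM2l//; first lra.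
by rewrite -enorm_flux// normr_edot_le.
Qed.

Lemma normr_edot_flux_le p w z : 1 < p ->
  `|edot (p_flux p w) z| <= enorm w `^ p + enorm z `^ p.
Proof.
move=> p1; have p0 : 0 < p by lra.
have := edot_flux_le w z p1.
have := powR_ge0 (enorm z) p; have := powR_ge0 (enorm w) p.
move: (enorm w `^ p) (enorm z `^ p) `|_| => A B C A0 B0 H0.
have H1 : 0 <= (p - 1) * B by rewrite mulr_ge0// subr_ge0 ltW.
suff : p * C <= p * (A + B) by rewrite ler_pM2l.
by lra.
Qed.

(** The flux paired with [w] is the [p]-th power of its norm, so this tangent inequality is
    Cauchy-Schwarz and Young combined; no derivative of the norm is computed. *)
Lemma enorm_powR_convex p w z : 1 < p ->
  enorm w `^ p + p * edot (p_flux p w) (z - w) <= enorm z `^ p.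
Proof.
move=> p1; rewrite edotBr edot_flux_self//.
have := edot_flux_le w z p1.
have : p * edot (p_flux p w) z <= p * `|edot (p_flux p w) z|.
  by rewrite ler_wpM2l ?ler_norm//; lra.
by rewrite mulrBr; lra.
Qed.

Lemma enormD_powR_le p w z : 1 < p ->
  enorm (w + z) `^ p <= 2 `^ p * (enorm w `^ p + enorm z `^ p).
Proof.
move=> p1; have p0 : 0 <= p by lra.
apply: (@le_trans _ _ ((2 * Num.max (enorm w) (enorm z)) `^ p)).
  rewrite ge0_ler_powR ?nnegrE ?enorm_ge0 ?mulr_ge0//.
    by rewrite le_max enorm_ge0.
  rewrite (le_trans (enormD _ _))// mulrDl mul1r.
  by rewrite lerD// le_max lexx ?orbT.
rewrite powRM//; last by rewrite le_max enorm_ge0.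
rewrite ler_wpM2l ?powR_ge0//.
case: (leP (enorm w) (enorm z)) => _; first by rewrite lerDr powR_ge0.
by rewrite lerDl powR_ge0.
Qed.

(** For [p < 2] the scalar factor of the flux is singular at 0. When [w = 0] homogeneity gives the
    explicit value [t]^ (p - 1) * enorm z [^ p] along the ray, which tends to 0 as [1 < p]; when
    [w != 0] all factors are continuous near [w]. *)
Lemma flux_cvg p w z : 1 < p ->
  edot (p_flux p (w + k.+1%:R^-1 *: z)) z @[k --> \oo] --> edot (p_flux p w) z.
Proof.
move=> p1.
have h0 : k.+1%:R^-1 @[k --> \oo] --> (0 : R) by exact: (@cvg_harmonic R).
have [->|w0] := eqVneq w 0.
  rewrite (_ : p_flux p 0 = 0); last by rewrite /p_flux scaler0.
  rewrite edot0l.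
  have -> : (fun k => edot (p_flux p (0 + k.+1%:R^-1 *: z)) z) =
    (fun k => (k.+1%:R^-1 `^ (p - 1)) * enorm z `^ p).
    apply/funext => k; have k0 : 0 < k.+1%:R^-1 :> R by rewrite invr_gt0.
    rewrite add0r -[in RHS]edot_flux_self// /p_flux enormZ gtr0_norm//.
    rewrite powRM ?enorm_ge0 ?(ltW k0)// !edotZl.
    have -> : p - 1 = (p - 2) + 1 by ring.
    rewrite [in RHS]powRD; last by rewrite (gt_eqF k0) implybT.
    by rewrite powRr1 ?(ltW k0)//; ring.
  rewrite -[X in _ --> X](mul0r (enorm z `^ p)); apply: cvgM; last exact:
      cvg_cst.
  have /cvg_at_rightP := powR_cvg0 (x := p - 1) (ltac:(lra)).
  by apply; split => // k; rewrite invr_gt0.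
have wz : w + k.+1%:R^-1 *: z @[k --> \oo] --> w.
  rewrite -[X in _ --> X]addr0; apply: cvgD; first exact: cvg_cst.
  by rewrite -[X in _ --> X](scale0r z); apply: cvgZ => //; exact: cvg_cst.
have en : enorm (w + k.+1%:R^-1 *: z) @[k --> \oo] --> enorm w.
  apply: (@cvg_comp _ _ _ (fun k : nat => w + k.+1%:R^-1 *: z) (@enorm R n) _
      _ _ wz).
  exact: continuous_enorm.
have ew : 0 < enorm w by rewrite lt_def enorm_eq0 w0 enorm_ge0.
have -> : (fun k => edot (p_flux p (w + k.+1%:R^-1 *: z)) z) =
  (fun k => enorm (w + k.+1%:R^-1 *: z) `^ (p - 2) * (edot w z + k.+1%:R^-1 *
      edot z z)).
  by apply/funext => k; rewrite /p_flux edotZl edotDl edotZl.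
rewrite /p_flux edotZl; apply: cvgM.
  have cp : {for enorm w, continuous (fun t : R => t `^ (p - 2))}.
    apply/differentiable_continuous/derivable1_diffP.
    by apply: derivable_powR; rewrite in_itv/= ew.
  exact: (@cvg_comp _ _ _ (fun k : nat => enorm (w + k.+1%:R^-1 *: z)) (fun t
      => t `^ (p - 2)) _ _ _ en cp).
rewrite -[X in _ --> X]addr0; apply: cvgD; first exact: cvg_cst.
by rewrite -[X in _ --> X](mul0r (edot z z)); apply: cvgM => //; exact: cvg_cst.
Qed.

End vectors.

Lemma normr_powR_convex {R : realType} (p a b : R) : 1 < p ->
  `|a| `^ p + p * (`|a| `^ (p - 2) * a * b) <= `|a + b| `^ p.
Proof.
move=> p1; pose c (r : R) : 'rV[R]_1 := const_mx r.
have E r : enorm (c r) = `|r| by rewrite /enorm big_ord1 mxE sqrtr_sqr.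
have := enorm_powR_convex (c a) (c (a + b)) p1.
rewrite /p_flux edotZl !E /edot big_ord1 !mxE.
by rewrite [a + b - a]addrC addKr !mulrA.
Qed.

(** * Energy and similarities *)

Section similarity.
Context {R : realType} {n : nat}.
Implicit Types (a b w : 'rV[R]_n).

Lemma mulmx_tr_edot a b : a *m b^T = (edot a b)%:M.
Proof. by apply/matrixP => i j; rewrite !ord1 [RHS]mxE eqxx mulr1n edotE. Qed.

Lemma householder_orthogonal w : w != 0 ->
  let H := 1%:M - (2 / edot w w) *: (w^T *m w) in H *m H^T = 1%:M.
Proof.
move=> w0 H; have ww : edot w w != 0 by rewrite -enorm_sqr expf_neq0//
    enorm_eq0.
have HT : H^T = H by rewrite /H linearB/= trmx1 linearZ/= trmx_mul trmxK.
rewrite HT /H mulmxBl mul1mx mulmxBr mulmx1 -scalemxAr -scalemxAl scalerA.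
rewrite -mulmxA [w *m _]mulmxA mulmx_tr_edot mul_scalar_mx -scalemxAr scalerA.
rewrite -scalerBl -addrA -opprD -scalerDl.
set k := 2 / _; rewrite (_ : k + (k - k * k * edot w w) = 0) ?scale0r ?subr0//.
by rewrite /k; field.
Qed.

(** The Householder reflection along [w], the difference of the normalized vectors, exchanges them;
    scaling by [s] then adjusts the length. If [w = 0] the vectors are already aligned and a
    homothety suffices. *)
Lemma similarity_matrix a b : a != 0 -> b != 0 ->
  exists M : 'M[R]_n, M *m M^T = ((enorm b / enorm a) ^+ 2)%:M /\ a *m M = b.
Proof.
move=> a0 b0; have ea : enorm a != 0 by rewrite enorm_eq0.
have eb : enorm b != 0 by rewrite enorm_eq0.
pose s := enorm b / enorm a.
pose w := (enorm a)^-1 *: a - (enorm b)^-1 *: b.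
have [w0|w0] := eqVneq w 0.
  exists s%:M; rewrite tr_scalar_mx -scalar_mxM -expr2; split => //.
  rewrite mul_mx_scalar /s -scalerA.
  by move/eqP: w0; rewrite subr_eq0 => /eqP ->; rewrite scalerA divff// scale1r.
have ww : edot w w != 0 by rewrite -enorm_sqr expf_neq0// enorm_eq0.
exists (s *: (1%:M - (2 / edot w w) *: (w^T *m w))); split.
  have TZ (c : R) (M : 'M[R]_n) : (c *: M)^T = c *: M^T.
    by apply/matrixP => i j; rewrite !mxE.
  rewrite TZ -scalemxAl -scalemxAr householder_orthogonal// scalerA.
  by rewrite scale_scalar_mx mulr1 -expr2.
(* Both normalized vectors have length 1, so the square of the norm of [w] is twice the pairing of
   the first of them with [w]. *)
have aw : edot a w = enorm a * (edot w w / 2).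
  rewrite /w !(edotBr, edotZr) [edot (_ - _) a]edotC [edot (_ - _) b]edotC.
  rewrite !(edotBr, edotZr) -!enorm_sqr (edotC b a).
  by field; rewrite ea eb.
rewrite -scalemxAr mulmxBr mulmx1 -scalemxAr mulmxA mulmx_tr_edot
    mul_scalar_mx scalerA.
rewrite aw (_ : 2 / edot w w * _ = enorm a); last by field.
have -> : enorm a *: w = a - (enorm a / enorm b) *: b.
  by rewrite /w scalerBr !scalerA divff// scale1r.
rewrite opprB addrC subrK scalerA.
by rewrite (_ : _ * _ = 1) ?scale1r// /s; field; rewrite ea eb.
Qed.

End similarity.

Section energy.
Context {R : realType} {n : nat}.
Local Notation mu := (@lebesgue_rV R n).
Implicit Types (u v : 'rV[R]_n -> R) (G H : 'rV[R]_n -> 'rV[R]_n).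
Variable p : R.
Hypothesis p1 : 1 < p.

Let p1' : 1 <= p. Proof. exact: ltW. Qed.
Let p0 : 0 < p. Proof. exact: lt_trans p1. Qed.

Lemma measurable_enorm_comp G : measurable_fun setT G ->
  measurable_fun setT (fun x => enorm (G x)).
Proof.
move=> mG; apply: (measurableT_comp _ mG).
by apply: continuous_measurable_rV; exact: continuous_enorm.
Qed.

Lemma measurable_enorm_powR (q : R) G : measurable_fun setT G ->
  measurable_fun setT (fun x => enorm (G x) `^ q).
Proof.
move=> mG; apply: (measurableT_comp (measurable_powR _)).
exact: measurable_enorm_comp.
Qed.

Lemma measurable_edot_flux G H : measurable_fun setT G -> measurable_fun setT
    H ->
  measurable_fun setT (fun x => edot (p_flux p (G x)) (H x)).
Proof.
move=> mG mH.
have -> : (fun x => edot (p_flux p (G x)) (H x)) =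
    (fun x => enorm (G x) `^ (p - 2) * edot (G x) (H x)).
  by apply/funext => x; rewrite /p_flux edotZl.
apply: measurable_funM; first exact: measurable_enorm_powR.
apply: measurable_sum => i; apply: measurable_funM.
  by move/measurable_fun_rVP: mG.
by move/measurable_fun_rVP: mH.
Qed.

Lemma energy_integrable u G : is_wgrad p u G ->
  mu.-integrable setT (fun x => (enorm (G x) `^ p)%:E).
Proof.
move=> HG; have mG := is_wgrad_measurable HG.
have Hi i : mu.-integrable setT (fun x => (`|G x ord0 i| `^ p)%:E).
  by have [_ /(Lfun_powR_integrableP _ p1')[]] := HG i.
have : mu.-integrable setT (fun x => (n%:R `^ p)%:E * \sum_i (`|G x ord0 i| `^
    p)%:E)%E.
  by apply: integrableZl => //; apply: integrable_sum.
apply: le_integrable => //.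
  by apply/measurable_EFinP; exact: measurable_enorm_powR.
move=> x _; rewrite sumEFin -EFinM !abse_EFin lee_fin.
rewrite !ger0_norm ?powR_ge0 ?enorm_powR_le_sum// mulr_ge0 ?powR_ge0//.
by apply: sumr_ge0 => i _; exact: powR_ge0.
Qed.

Lemma flux_integrable u v G H : is_wgrad p u G -> is_wgrad p v H ->
  mu.-integrable setT (fun x => (edot (p_flux p (G x)) (H x))%:E).
Proof.
move=> HG HH; have mG := is_wgrad_measurable HG; have mH :=
    is_wgrad_measurable HH.
have := integrableD measurableT (energy_integrable HG) (energy_integrable HH).
apply: le_integrable => //.
  by apply/measurable_EFinP; exact: measurable_edot_flux.
move=> x _; rewrite -EFinD !abse_EFin lee_fin.
rewrite [leRHS]ger0_norm ?addr_ge0 ?powR_ge0//.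
exact: normr_edot_flux_le.
Qed.

Definition energy u := fine (\int[mu]_x (enorm (wgrad u x) `^ p)%:E)%E.

Lemma energyE u : D1p p u -> (\int[mu]_x (enorm (wgrad u x) `^ p)%:E = (energy
    u)%:E)%E.
Proof.
move=> Du; rewrite fineK//; apply: integrable_fin_num => //.
exact: energy_integrable (is_wgrad_wgrad p1' Du).
Qed.

Lemma energy_ge0 u : 0 <= energy u.
Proof. by apply/fine_ge0/integral_ge0 => x _; rewrite lee_fin powR_ge0. Qed.

Lemma energy_is_wgrad u G : is_wgrad p u G -> D1p p u ->
  (\int[mu]_x (enorm (G x) `^ p)%:E = (energy u)%:E)%E.
Proof.
move=> HG Du; rewrite -(energyE Du); have Hw := is_wgrad_wgrad p1' Du.
apply: ge0_ae_eq_integral => //.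
- by apply/measurable_EFinP; apply: measurable_enorm_powR; exact:
    is_wgrad_measurable HG.
- by apply/measurable_EFinP; apply: measurable_enorm_powR; exact:
    is_wgrad_measurable Hw.
- by move=> x _; rewrite lee_fin powR_ge0.
- by move=> x _; rewrite lee_fin powR_ge0.
- by apply: filterS (is_wgrad_unique HG Hw) => x E _; rewrite E.
Qed.

Lemma grad_LnormE u : D1p p u -> grad_Lnorm p u = (energy u `^ p^-1)%:E.
Proof.
move=> Du; rewrite /grad_Lnorm unlock -poweR_EFin -(energyE Du); congr (_ `^
    _)%E.
by apply: eq_integral => x _; rewrite abse_EFin ger0_norm ?enorm_ge0.
Qed.

Lemma energy_eq0 u : D1p p u -> energy u = 0 -> {ae mu, forall x, wgrad u x =
    0}.
Proof.
move=> Du E0; have Hw := is_wgrad_wgrad p1' Du.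
have : (\int[mu]_x `|(enorm (wgrad u x) `^ p)%:E| = 0)%E.
  rewrite -[RHS]/(0%:E) -E0 -(energyE Du); apply: eq_integral => x _.
  by rewrite abse_EFin ger0_norm ?powR_ge0.
move=> /ae_eq_integral_abs H.
have : ae_eq mu setT (fun x => (enorm (wgrad u x) `^ p)%:E) (cst 0%E).
  apply: H => //; apply/measurable_EFinP; apply: measurable_enorm_powR.
  exact: is_wgrad_measurable Hw.
apply: filterS => x /(_ I) [] /powR_eq0_eq0 /eqP.
by rewrite enorm_eq0 => /eqP.
Qed.

Lemma energy_eq0_cst u : D1p p u -> energy u = 0 -> forall x y, u x = u y.
Proof.
move=> Du /(energy_eq0 Du) E0; have [cu _ _] := Du.
apply: weak_gradient_eq0_cst => // i phi tphi.
have [[_ W] _] := is_wgrad_wgrad p1' Du i; rewrite (W _ tphi).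
rewrite -oppe0; congr (- _)%E.
transitivity (\int[mu]_x (cst 0%E x))%E; last exact: integral0.
apply: ae_eq_integral => //.
  apply/measurable_EFinP; apply: measurable_funM.
    by have /measurable_fun_rVP := is_wgrad_measurable (is_wgrad_wgrad p1' Du).
  by apply: continuous_measurable_rV; exact: (test_function_continuous tphi).
by apply: filterS E0 => x -> _; rewrite mxE mul0r.
Qed.

Lemma energy_cst (c : R) : energy (cst c) = 0.
Proof.
have := energy_is_wgrad (is_wgrad_cst c p1') (D1p_cst c p1').
have e0 : enorm (0 : 'rV[R]_n) = 0 by apply/eqP; rewrite enorm_eq0.
under eq_integral do rewrite /= e0 powR0 ?gt_eqF//.
by rewrite integral0 => -[].
Qed.

Lemma energy_affine (A : 'M[R]_n) (b : 'rV[R]_n) (s al be : R) u : 0 < s ->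
  A *m A^T = (s ^+ 2)%:M -> D1p p u ->
  energy (fun x => al * u (x *m A + b) + be) = `|al| `^ p * s `^ (p - n%:R) *
      energy u.
Proof.
move=> s0 AA Du; have [cu _ _] := Du; have Hw := is_wgrad_wgrad p1' Du.
have DuT := D1p_affine b p1' s0 AA Du; have [cuT _ _] := DuT.
have HT := is_wgrad_affine b p1' s0 AA cu Hw.
have Hc := is_wgrad_lin al p1' cuT (fun x => @cst_continuous _ _ be x) HT
    (is_wgrad_cst be p1').
have Dc := D1p_lin al p1' DuT (D1p_cst be p1').
have E1 := energy_is_wgrad Hc Dc.
apply: EFin_inj; rewrite -E1.
(* The hypothesis concerns [A *m A^T], while the norm of [y *m A^T] involves the product in the
   other order; a one-sided inverse of a square matrix is two-sided. *)
have ATA : A^T *m A = (s ^+ 2)%:M.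
  have s20 : s ^+ 2 != 0 by rewrite expf_neq0// gt_eqF.
  have : A *m (s ^- 2 *: A^T) = 1%:M by rewrite -scalemxAr AA scale_scalar_mx
      mulVf.
  move=> /mulmx1C; rewrite -scalemxAl => /(congr1 (fun M => s ^+ 2 *: M)).
  by rewrite scalerA divff// scale1r scalemx1.
have enA y : enorm (y *m A^T) = s * enorm y.
  apply: (@pexpIrn _ 2) => //; rewrite ?nnegrE ?enorm_ge0 ?mulr_ge0 ?enorm_ge0
      ?(ltW s0)//.
  rewrite exprMn !enorm_sqr !edotE trmx_mul trmxK -mulmxA [A^T *m _]mulmxA ATA.
  by rewrite mul_scalar_mx -scalemxAr mxE.
have sT := scales_similarity b s0 AA.
have mw := measurable_enorm_powR p (is_wgrad_measurable Hw).
transitivity (\int[mu]_x ((`|al| `^ p * s `^ p) * enorm (wgrad u (x *m A + b))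
    `^ p)%:E)%E.
  apply: eq_integral => x _; rewrite addr0 enormZ enA.
  by rewrite !powRM ?mulr_ge0 ?enorm_ge0 ?(ltW s0)// mulrA.
under eq_integral do rewrite EFinM.
rewrite ge0_integralZl ?lee_fin ?mulr_ge0 ?powR_ge0//; last 2 first.
  by apply/measurable_EFinP; case: sT => mT _ _; exact: (measurableT_comp mw
      mT).
  by move=> *; rewrite lee_fin powR_ge0.
rewrite (scales_ge0_integral (f := fun x => (enorm (wgrad u x) `^ p)%:E) sT).
- rewrite (energyE Du) -!EFinM; congr EFin; rewrite powRB ?(gt_eqF s0)
    ?implybT//.
  by rewrite powR_mulrn ?(ltW s0)//; ring.
- exact/measurable_EFinP.
- by move=> x; rewrite lee_fin powR_ge0.
Qed.

End energy.

(** In its use [e] and [e'] are the energies of [u] and of its perturbation by [s *: phi], [y] is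
    the perturbed increment to the power [p], and [j] is the flux of the perturbed gradient against
    that of [phi]. Chaining the bounds leaves a factor [p * s] to divide by. *)
Lemma difference_quotient_algebra {R : realType} (p kappa c j s e e' y b : R) :
  0 < p * s ->
  kappa * e + p * (c * (s * b)) <= y -> y <= kappa * e' ->
  kappa * (e' - p * s * j) <= kappa * e -> c * b <= kappa * j.
Proof.
move=> ps h1 h2 h3; have h4 := le_trans h1 h2.
suff : p * s * (c * b) <= p * s * (kappa * j) by rewrite ler_pM2l.
by lra.
Qed.

Lemma dominating_algebra {R : realType} (a b c d : R) :
  0 <= a -> d <= c * (b + a) + b -> d <= (c + 1) * (a + b).
Proof. by move=> a0 h; lra. Qed.

Lemma lee_EFin_eq {R : realType} (x y : \bar R) (a b : R) :
  (x <= y)%E -> x = a%:E -> y = b%:E -> a <= b.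
Proof. by move=> /[swap] -> /[swap] ->; rewrite lee_fin. Qed.

Lemma ler_wpM2l_eq {R : realType} (q Q a l L : R) :
  0 <= q -> l <= a * L -> q * a = Q -> q * l <= Q * L.
Proof. by move=> q0 lL <-; rewrite -mulrA; exact: ler_wpM2l. Qed.

(** Combines the one-sided bounds for [phi] and for its opposite, the latter in the form
    [-1 * phi + 0] produced by [D1p_lin], into an equality. *)
Lemma opposite_bounds_algebra {R : realType} (c x y k i : R) : 0 < k ->
  c * (x - y) <= k * i -> c * (-1 * x + 0 - (-1 * y + 0)) <= k * - i ->
  i = c / k * (x - y).
Proof.
move=> k0 h1 h2; have kN0 : k != 0 by rewrite gt_eqF.
apply: (mulfI kN0).
rewrite (_ : k * (c / k * (x - y)) = c * (x - y)); last by field.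
by apply/eqP; rewrite eq_le; apply/andP; split; lra.
Qed.

(** * The three implications *)

Section main.
Context {R : realType} {n : nat}.
Local Notation mu := (@lebesgue_rV R n).
Implicit Types (u v phi : 'rV[R]_n -> R) (x y : 'rV[R]_n).
Variable p : R.
Hypothesis p1 : 1 < p.

Let p1' : 1 <= p. Proof. exact: ltW. Qed.
Let p0 : 0 < p. Proof. exact: lt_trans p1. Qed.

Definition euler_lagrange u x0 y0 := exists c : R, forall phi, D1p p phi ->
  (\int[mu]_x (edot (p_flux p (wgrad u x)) (wgrad phi x))%:E
   = (c * (phi x0 - phi y0))%:E)%E.

Definition minimizer u x0 y0 := forall v, D1p p v -> v x0 = u x0 -> v y0 = u
    y0 ->
  (\int[mu]_x (enorm (wgrad u x) `^ p)%:E
   <= \int[mu]_x (enorm (wgrad v x) `^ p)%:E)%E.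

Lemma flux_integral_is_wgrad u phi H : D1p p u -> is_wgrad p phi H -> D1p p
    phi ->
  (\int[mu]_x (edot (p_flux p (wgrad u x)) (wgrad phi x))%:E =
   \int[mu]_x (edot (p_flux p (wgrad u x)) (H x))%:E)%E.
Proof.
move=> Du HH Dphi; have Hu := is_wgrad_wgrad p1' Du; have Hp := is_wgrad_wgrad
    p1' Dphi.
have /integrableP[m1 _] := flux_integrable p1 Hu Hp.
have /integrableP[m2 _] := flux_integrable p1 Hu HH.
apply: ae_eq_integral => //.
by apply: filterS (is_wgrad_unique Hp HH) => x E _; rewrite E.
Qed.

Lemma euler_lagrange_minimizer u x0 y0 : D1p p u ->
  euler_lagrange u x0 y0 -> minimizer u x0 y0.
Proof.
move=> Du [c Hc] v Dv vx vy.
have Hu := is_wgrad_wgrad p1' Du; have Hv := is_wgrad_wgrad p1' Dv.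
have [cu _ _] := Du; have [cv _ _] := Dv.
have Hphi := is_wgrad_lin (-1) p1' cu cv Hu Hv.
have Dphi := D1p_lin (-1) p1' Du Dv.
(* The difference of [v] and [u] vanishes at both points, so the right-hand side is 0 whatever [c]
   is. *)
have := Hc _ Dphi; rewrite (flux_integral_is_wgrad Du Hphi Dphi) vx vy.
rewrite !mulN1r !addNr subrr mulr0 => J0.
have iJ := flux_integrable p1 Hu Hphi.
have iE := energy_integrable p1 Hu; have iF := energy_integrable p1 Hv.
have E0 := integral_lin p iJ iE; rewrite J0 mule0 add0e in E0.
have L := le_integral_EFin (integrable_lin p iJ iE) iF.
apply: (eq_ind _ (fun z => (z <= _)%E) (L _) _ E0) => x.
rewrite scaleN1r addrC [- _ + _]addrC.
exact: enorm_powR_convex.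
Qed.

(* The convexity inequalities below bound both sides of the Gateaux difference
   quotient, so that no differentiation under the integral sign is needed. *)
Lemma touching_flux_le u phi H (kappa a b : R) : D1p p u -> D1p p phi ->
    is_wgrad p phi H ->
  0 < kappa ->
  (forall t : R, `|a + t * b| `^ p <= kappa * energy p (fun x => t * phi x + u
      x)) ->
  `|a| `^ p = kappa * energy p u ->
  `|a| `^ (p - 2) * a * b <=
    kappa * fine (\int[mu]_x (edot (p_flux p (wgrad u x)) (H x))%:E)%E.
Proof.
move=> Du Dphi HH k0 Hle Heq.
have Hu := is_wgrad_wgrad p1' Du.
have [cu _ _] := Du; have [cphi _ _] := Dphi.
pose t k : R := k.+1%:R^-1.
have t0 k : 0 < t k by rewrite invr_gt0.
pose G k := (fun x => t k *: H x + wgrad u x).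
have HG k : is_wgrad p (fun x => t k * phi x + u x) (G k) by exact:
    is_wgrad_lin.
have DG k : D1p p (fun x => t k * phi x + u x) by exact: D1p_lin.
have iJ k := flux_integrable p1 (HG k) HH.
have iE k := energy_integrable p1 (HG k).
have iU := energy_integrable p1 Hu.
pose J k := fine (\int[mu]_x (edot (p_flux p (G k x)) (H x))%:E)%E.
have JE k : (\int[mu]_x (edot (p_flux p (G k x)) (H x))%:E = (J k)%:E)%E.
  by rewrite fineK//; exact: integrable_fin_num (iJ k).
(* The tangent inequality is taken at the perturbed gradient [G k] and evaluated at [wgrad u], which
   bounds the growth of the energy from above by [p * t k * J k]; the scalar tangent inequality
   bounds the increment from below. It remains to let [t k] tend to 0 in [J k]. *)
have step k : `|a| `^ (p - 2) * a * b <= kappa * J k.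
  have h1 : energy p (fun x => t k * phi x + u x) - p * t k * J k <= energy p u.
    have := integral_lin (- (p * t k)) (iJ k) (iE k).
    rewrite JE (energy_is_wgrad p1 (HG k) (DG k)) -EFinM -EFinD => E0.
    rewrite -lee_fin -(energyE p1 Du) addrC -mulNr -E0.
    apply: (le_integral_EFin (integrable_lin _ (iJ k) (iE k)) iU) => x.
    apply: le_trans (enorm_powR_convex (G k x) (wgrad u x) p1).
    rewrite (_ : wgrad u x - G k x = (- t k) *: H x); last first.
      by rewrite /G opprD addrCA subrr addr0 scaleNr.
    rewrite edotZr; move: (edot _ _) (_ `^ _) (t k) => c d s; lra.
  have h2 := normr_powR_convex a (t k * b) p1.
  have h3 := Hle (t k).
  have h4 : kappa * (energy p (fun x => t k * phi x + u x) - p * t k * J k) <=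
      kappa * energy p u.
    by rewrite ler_pM2l.
  have ptk : 0 < p * t k by rewrite mulr_gt0.
  by rewrite Heq in h2; exact: difference_quotient_algebra ptk h2 h3 h4.
have iH := energy_integrable p1 HH.
have cvgJ : (\int[mu]_x (edot (p_flux p (G k x)) (H x))%:E)%E @[k --> \oo] -->
    (\int[mu]_x (edot (p_flux p (wgrad u x)) (H x))%:E)%E.
  apply: (@dominated_cvg _ _ _ mu setT measurableT _ _
    (fun x => ((2 `^ p + 1) * (enorm (wgrad u x) `^ p + enorm (H x) `^
        p))%:E)) => //.
  - by move=> k; have /integrableP[] := iJ k.
  - move=> x _; apply: cvg_EFin; first exact: nearW.
    under eq_fun do rewrite /G addrC.
    exact: flux_cvg.
  - exact: (integrableZl measurableT (2 `^ p + 1) (integrableD measurableT iU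
      iH)).
  - move=> k x _; rewrite abse_EFin lee_fin.
    have h1 := normr_edot_flux_le (G k x) (H x) p1.
    have h2 := enormD_powR_le (t k *: H x) (wgrad u x) p1.
    have h3 : enorm (t k *: H x) `^ p <= enorm (H x) `^ p.
      rewrite ge0_ler_powR ?nnegrE ?enorm_ge0 ?(ltW p0)// enormZ gtr0_norm//.
      by rewrite ler_piMl ?enorm_ge0// invf_le1// ler1n.
    have h4 : 2 `^ p * (enorm (t k *: H x) `^ p + enorm (wgrad u x) `^ p) <=
        2 `^ p * (enorm (H x) `^ p + enorm (wgrad u x) `^ p).
      by apply: ler_wpM2l; [exact: powR_ge0|rewrite lerD2r].
    have h5 := le_trans h2 h4; have h6 := le_trans h1 (lerD h5 (lexx _)).
    exact: dominating_algebra (powR_ge0 _ _) h6.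
have {}cvgJ : J k @[k --> \oo] --> fine (\int[mu]_x (edot (p_flux p (wgrad u
    x)) (H x))%:E)%E.
  apply: fine_cvg; rewrite fineK//.
  exact: integrable_fin_num (flux_integrable p1 Hu HH).
have {}cvgJ : kappa * J k @[k --> \oo] -->
    kappa * fine (\int[mu]_x (edot (p_flux p (wgrad u x)) (H x))%:E)%E.
  by apply: cvgM; [exact: cvg_cst|exact: cvgJ].
rewrite -(cvg_lim _ cvgJ)//; apply: limr_ge; first by apply/cvg_ex; eexists;
    exact: cvgJ.
by apply: nearW => k; exact: step.
Qed.

Lemma enorm_sub_gt0 x y : x != y -> 0 < enorm (x - y).
Proof. by move=> xy; rewrite lt_def enorm_ge0 enorm_eq0 subr_eq0 xy. Qed.

Lemma enorm_subC x y : enorm (x - y) = enorm (y - x).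
Proof. by rewrite -enormN opprB. Qed.

Lemma holder_quotient_ge0 u x y : 0 <= holder_quotient p u x y.
Proof. by rewrite /holder_quotient divr_ge0// powR_ge0. Qed.

Lemma holder_quotient_le_seminorm u x y : x != y ->
  ((holder_quotient p u x y)%:E <= holder_seminorm p u)%E.
Proof. by move=> xy; apply: ereal_sup_ubound; exists (x, y). Qed.

Lemma holder_seminorm_le u (M : \bar R) :
  (forall x y, x != y -> ((holder_quotient p u x y)%:E <= M)%E) ->
  (holder_seminorm p u <= M)%E.
Proof. by move=> H; apply: ge_ereal_sup => _ [[x y] /= xy <-]; exact: H. Qed.

Lemma holder_seminorm_cst u x0 y0 : x0 != y0 -> (forall x y, u x = u y) ->
  holder_seminorm p u = 0%E.
Proof.
move=> xy uc; apply/eqP; rewrite eq_le; apply/andP; split.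
  apply: holder_seminorm_le => x y _.
  by rewrite /holder_quotient (uc x y) subrr normr0 mul0r.
apply: le_trans (holder_quotient_le_seminorm u xy).
by rewrite lee_fin holder_quotient_ge0.
Qed.

Lemma powR_mul_root (c e : R) : 0 <= c -> 0 <= e ->
  (c * e `^ p^-1) `^ p = c `^ p * e.
Proof.
by move=> c0 e0; rewrite powRM ?powR_ge0// -powRrM mulVf ?gt_eqF// powRr1.
Qed.

(** The constant is an infimum, not known to be itself a bound. For [L > 0] dividing by [L] compares
    the quotient with every bound; for [L = 0] a single bound suffices, and one exists because the
    infimum of the empty set would be [+oo]. *)
Lemma morrey_quotient_le K v x y : @morrey_constant R n p = K%:E -> D1p p v ->
    x != y ->
  holder_quotient p v x y <= K * energy p v `^ p^-1.
Proof.
move=> KE Dv xy; set q := holder_quotient _ _ _ _; set L := _ `^ _.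
have qC (C : R) : @morrey_bound R n p C -> q <= C * L.
  move=> /(_ _ Dv); rewrite (grad_LnormE p1 Dv) -EFinM => H.
  by rewrite -lee_fin; exact: le_trans (holder_quotient_le_seminorm v xy) H.
have [L0|L0] := eqVneq L 0.
  have [C HC] : exists C : R, @morrey_bound R n p C.
    apply: contrapT => H; move: KE; rewrite /morrey_constant.
    rewrite (_ : [set C%:E | C in _] = set0) ?ereal_inf0//.
    by rewrite -subset0 => z [C HC _]; apply: H; exists C.
  by have := qC _ HC; rewrite L0 !mulr0.
have {}L0 : 0 < L by rewrite lt_def L0 powR_ge0.
rewrite -ler_pdivrMr// -lee_fin -KE; apply: le_ereal_inf_tmp => _ [C HC <-].
by rewrite lee_fin ler_pdivrMr//; exact: qC.
Qed.

Lemma extremal_euler_lagrange u x0 y0 : x0 != y0 -> D1p p u ->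
  holder_seminorm p u = (@morrey_constant R n p * grad_Lnorm p u)%E ->
  holder_seminorm p u = (holder_quotient p u x0 y0)%:E -> euler_lagrange u x0
      y0.
Proof.
move=> xy Du uC uq.
have [E0|E0] := eqVneq (energy p u) 0.
  exists 0 => phi Dphi; rewrite mul0r.
  have /integrableP[mf _] := flux_integrable p1 (is_wgrad_wgrad p1' Du)
      (is_wgrad_wgrad p1' Dphi).
  transitivity (\int[mu]_x (cst 0%E x))%E; last exact: integral0.
  apply: ae_eq_integral => //.
  by apply: filterS (energy_eq0 p1 Du E0) => x -> _; rewrite /p_flux scaler0
      edot0l.
have {}E0 : 0 < energy p u by rewrite lt_def E0 energy_ge0.
have L0 : 0 < energy p u `^ p^-1 by rewrite powR_gt0.
rewrite uq (grad_LnormE p1 Du) in uC.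
(* An infinite constant times the positive norm would be infinite, whereas the product is an actual
   quotient. *)
have [K KE] : exists K : R, @morrey_constant R n p = K%:E.
  move: uC; case: (@morrey_constant R n p) => [K _||]; first by exists K.
    by rewrite gt0_mulye ?lte_fin.
  by rewrite gt0_mulNye ?lte_fin.
have qK : holder_quotient p u x0 y0 = K * energy p u `^ p^-1.
  by move: uC; rewrite KE => -[].
(* With [K = 0] the seminorm would vanish, so [u] would be constant and its energy 0. *)
have K0 : 0 < K.
  rewrite lt_def; apply/andP; split; last first.
    by rewrite -(pmulr_lge0 _ L0) -qK holder_quotient_ge0.
  apply/eqP => K0; move: E0; rewrite (_ : energy p u = 0) ?ltxx//.
  rewrite (_ : u = cst (u 0)); first exact: energy_cst.
  apply/funext => x; apply: contrapT => /eqP ux.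
  have [x00|x00] := eqVneq x 0; first by rewrite x00 eqxx in ux.
  have := holder_quotient_le_seminorm u x00.
  rewrite uq qK K0 mul0r lee_fin leNgt => /negP; apply.
  by rewrite divr_gt0 ?powR_gt0 ?enorm_sub_gt0// normr_gt0 subr_eq0.
pose d := enorm (x0 - y0) `^ (1 - n%:R / p).
have d0 : 0 < d by rewrite powR_gt0// enorm_sub_gt0.
(* Raising [|v x0 - v y0| <= K * d * ||Dv||] to the power [p] gives an inequality with constant
   [kappa] between two convex functions of [v], with equality at [u]. *)
pose kappa := (K * d) `^ p.
have Kd0 : 0 <= K * d by rewrite mulr_ge0 ?ltW.
have k0 : 0 < kappa by rewrite powR_gt0// mulr_gt0.
have Hle v : D1p p v -> `|v x0 - v y0| `^ p <= kappa * energy p v.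
  move=> Dv; have := morrey_quotient_le KE Dv xy.
  rewrite /holder_quotient -/d ler_pdivrMr// => H.
  rewrite mulrAC in H.
  rewrite -(powR_mul_root Kd0 (energy_ge0 p v)).
  by apply: ge0_ler_powR H; rewrite ?nnegrE ?(ltW p0)// mulr_ge0 ?powR_ge0.
pose a := u x0 - u y0.
have Heq : `|a| `^ p = kappa * energy p u.
  rewrite -(powR_mul_root Kd0 (energy_ge0 p u)); congr (_ `^ p).
  by rewrite mulrAC -qK /holder_quotient -/d divfK// gt_eqF.
(* The ratio of the derivatives of both sides at [u], the common factor [p] being cancelled. *)
exists (`|a| `^ (p - 2) * a / kappa) => phi Dphi.
have Hphi := is_wgrad_wgrad p1' Dphi.
have Ht f : D1p p f -> forall t : R, `|a + t * (f x0 - f y0)| `^ p <= kappa *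
    energy p (fun x => t * f x + u x).
  move=> Df t; have := Hle _ (D1p_lin t p1' Df Du).
  rewrite (_ : t * f x0 + u x0 - (t * f y0 + u y0) = a + t * (f x0 - f y0))//.
  by rewrite /a; ring.
have iJ := flux_integrable p1 (is_wgrad_wgrad p1' Du) Hphi.
have [I IE] := integral_fin iJ.
have h1 := touching_flux_le Du Dphi Hphi k0 (Ht _ Dphi) Heq.
(* The touching argument is one-sided; the opposite of [phi] yields the reverse inequality. *)
have D2 := D1p_lin (-1) p1' Dphi (D1p_cst 0 p1').
have [cphi _ _] := Dphi.
have H2 := is_wgrad_lin (-1) p1' cphi (fun x => @cst_continuous _ _ (0:R) x)
    Hphi (is_wgrad_cst 0 p1').
have h2 := touching_flux_le Du D2 H2 k0 (Ht _ D2) Heq.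
have I2 : (\int[mu]_x (edot (p_flux p (wgrad u x)) (-1 *: wgrad phi x + cst 0
    x))%:E = (- I)%:E)%E.
  under eq_integral do rewrite addr0 edotZr EFinM.
  by rewrite (integralZl measurableT iJ) IE -EFinM mulN1r.
rewrite I2 in h2; rewrite IE in h1 *; rewrite /= in h1 h2.
by congr EFin; exact: opposite_bounds_algebra k0 h1 h2.
Qed.

Lemma minimizer_energy_le u w x0 y0 : D1p p u -> D1p p w -> minimizer u x0 y0 ->
  w x0 = u x0 -> w y0 = u y0 -> energy p u <= energy p w.
Proof.
move=> Du Dw Hmin wx wy.
exact: (lee_EFin_eq (Hmin _ Dw wx wy) (energyE p1 Du) (energyE p1 Dw)).
Qed.

(** The comparison of ratios is cross-multiplied, which keeps its meaning when the energy of [v] or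
    of [u] is 0. *)
Lemma minimizer_quotient_le u v x0 y0 x y : x0 != y0 -> x != y -> D1p p u ->
    D1p p v ->
  minimizer u x0 y0 ->
  holder_quotient p v x y * energy p u `^ p^-1 <=
  holder_quotient p u x0 y0 * energy p v `^ p^-1.
Proof.
move=> xy0 xy Du Dv Hmin.
have [vxy|vxy] := eqVneq (v x) (v y).
  rewrite /holder_quotient vxy subrr normr0 !mul0r mulr_ge0 ?powR_ge0//.
  exact: holder_quotient_ge0.
have ne0 : y0 - x0 != 0 by rewrite subr_eq0 eq_sym.
have ne : y - x != 0 by rewrite subr_eq0 eq_sym.
have [M [MM xM]] := similarity_matrix ne0 ne.
set s := enorm (y - x) / enorm (y0 - x0) in MM.
have e0 : 0 < enorm (y0 - x0) by rewrite enorm_sub_gt0// eq_sym.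
have e1 : 0 < enorm (y - x) by rewrite enorm_sub_gt0// eq_sym.
have s0 : 0 < s by rewrite divr_gt0.
(* The affine normalization is forced by the values of the competitor at [x0] and [y0]; it divides
   by [v x - v y], whence the separate treatment of [v x = v y], where the left side is 0. *)
pose al := (u x0 - u y0) / (v x - v y); pose be := u x0 - al * v x.
pose bb := x - x0 *m M.
have Tx0 : x0 *m M + bb = x by rewrite /bb addrC subrK.
have Ty0 : y0 *m M + bb = y.
  by rewrite /bb addrCA -mulmxBl xM addrC subrK.
have Dw : D1p p (fun z => al * v (z *m M + bb) + be).
  exact: (D1p_lin al p1' (D1p_affine bb p1' s0 MM Dv) (D1p_cst be p1')).
have Ele : energy p u <= `|al| `^ p * s `^ (p - n%:R) * energy p v.
  rewrite -(energy_affine p1 bb al be s0 MM Dv).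
  apply: (minimizer_energy_le Du Dw Hmin).
    by rewrite Tx0 /be addrC subrK.
  by rewrite Ty0 /be /al; field; rewrite subr_eq0.
have Lle : energy p u `^ p^-1 <= `|al| * s `^ (1 - n%:R / p) * energy p v `^
    p^-1.
  have pV0 : 0 <= p^-1 by rewrite invr_ge0 ltW.
  apply: le_trans (ge0_ler_powR pV0 _ _ Ele) _; rewrite ?nnegrE ?mulr_ge0
      ?powR_ge0 ?energy_ge0//.
  rewrite powRM; [|by rewrite mulr_ge0 ?powR_ge0|exact: energy_ge0].
  rewrite powRM ?powR_ge0// -!powRrM divff ?gt_eqF// powRr1//.
  by rewrite (_ : (p - n%:R) / p = 1 - n%:R / p)//; field; rewrite gt_eqF.
(* The power of [s] gained by the energy cancels against the ratio of the two Hoelder denominators,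
   and [al] against the ratio of the increments. *)
apply: (ler_wpM2l_eq (holder_quotient_ge0 v x y) Lle).
rewrite /holder_quotient (enorm_subC x0 y0) (enorm_subC x y).
have -> : enorm (y - x) = s * enorm (y0 - x0) by rewrite /s divfK// gt_eqF.
rewrite powRM ?(ltW s0) ?enorm_ge0//.
have -> : `|u x0 - u y0| = `|v x - v y| * `|al|.
  by rewrite -normrM /al mulrC divfK// subr_eq0.
by field; rewrite !gt_eqF ?powR_gt0.
Qed.

(** For positive energy, [q / L] is a Morrey bound which [u] attains at [x0] and [y0]; no bound can
    be smaller, so it is the infimum. *)
Lemma minimizer_extremal u x0 y0 : x0 != y0 -> D1p p u -> minimizer u x0 y0 ->
  holder_seminorm p u = (@morrey_constant R n p * grad_Lnorm p u)%E /\
  holder_seminorm p u = (holder_quotient p u x0 y0)%:E.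
Proof.
move=> xy Du Hmin.
have [E0|E0] := eqVneq (energy p u) 0.
  have uc := energy_eq0_cst p1 Du E0.
  (* The function is constant, so its seminorm is 0, and the product on the right is 0 even for an
     infinite constant, by the convention for 0 times infinity. *)
  rewrite (holder_seminorm_cst xy uc) (grad_LnormE p1 Du) E0 powR0 ?invr_neq0
      ?gt_eqF//.
  by rewrite mule0 /holder_quotient (uc x0 y0) subrr normr0 mul0r.
have {}E0 : 0 < energy p u by rewrite lt_def E0 energy_ge0.
have L0 : 0 < energy p u `^ p^-1 by rewrite powR_gt0.
set q := holder_quotient p u x0 y0; set L := energy p u `^ p^-1 in L0.
have Kbound : @morrey_bound R n p (q / L).
  move=> v Dv; apply: holder_seminorm_le => x y xy1.
  rewrite (grad_LnormE p1 Dv) -EFinM lee_fin.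
  rewrite mulrAC ler_pdivlMr; last exact: L0.
  exact: minimizer_quotient_le.
have uq : holder_seminorm p u = q%:E.
  apply/eqP; rewrite eq_le; apply/andP; split; last exact:
      holder_quotient_le_seminorm.
  have := Kbound _ Du; rewrite (grad_LnormE p1 Du) -EFinM -/L divfK//.
  by rewrite gt_eqF.
split => //.
have -> : @morrey_constant R n p = (q / L)%:E.
  apply/eqP; rewrite eq_le; apply/andP; split.
    by apply: ereal_inf_lbound; exists (q / L).
  apply: le_ereal_inf_tmp => _ [C HC <-]; rewrite lee_fin ler_pdivrMr//.
  by have := HC _ Du; rewrite uq (grad_LnormE p1 Du) -EFinM lee_fin.
by rewrite uq (grad_LnormE p1 Du) -EFinM -/L divfK// gt_eqF.
Qed.

End main.

Theorem theorem2p4 (R : realType) (n : nat) (p : R) (x0 y0 : 'rV[R]_n)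
    (u : 'rV[R]_n -> R) :
  (0 < n)%N -> n%:R < p -> x0 != y0 -> D1p p u ->
  [<-> extremal p u /\ holder_seminorm p u = (holder_quotient p u x0 y0)%:E;
       exists c : R, forall phi : 'rV[R]_n -> R, D1p p phi ->
         (\int[lebesgue_rV]_x (edot (p_flux p (wgrad u x)) (wgrad phi x))%:E
          = (c * (phi x0 - phi y0))%:E)%E;
       forall v : 'rV[R]_n -> R, D1p p v -> v x0 = u x0 -> v y0 = u y0 ->
         (\int[lebesgue_rV]_x (enorm (wgrad u x) `^ p)%:E
          <= \int[lebesgue_rV]_x (enorm (wgrad v x) `^ p)%:E)%E].
Proof.
move=> n0 np xy Du; have p1 : 1 < p by apply: le_lt_trans np; rewrite ler1n.
split; first by move=> [[_ uC] uq]; exact: (extremal_euler_lagrange p1 xy Du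
    uC uq).
split; first exact: (euler_lagrange_minimizer p1 Du).
by move=> /(minimizer_extremal p1 xy Du)[uC uq]; split=> //; split.
Qed.
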